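(* Let $y:[0,1]\to\Omega_\mathbb{R}$ be a smooth path of control parameters, and let $z(0)\in\mathcal{LC}_{reg}$ with $\pi(z(0))=y(0)$ and $\dim T_{z(0)}\mathcal{LC}=\dim T_{y(0)}\Omega$, and suppose $y(t)\notin\mathcal{D}_\Omega$ for all $t\in[0,1]$, so that there is a smooth lifting $z:[0,1]\to\mathcal{LC}$ starting at $z(0)$ with $\pi(z(t))=y(t)$. If $z(0)$ is a strict local minimum (in the sense defined below), then $z(t)$ is a strict local minimum for every $t\in[0,1]$.
   Context: Elastic tensegrity framework: a graph on nodes $[n]=\{1,\dots,n\}$ with edge set $E=B\cup C$ (disjoint), $B$ the rigid bars and $C$ the elastic cables, embedded in dimension $d$ with node coordinates $p_i=(p_{i1},\dots,p_{id})$. The variables are $p_{ik}$ ($i\in[n],k\in[d]$), bar lengths $\ell_{ij}$ ($ij\in B$), cable resting lengths $r_{ij}$ ($ij\in C$) and cable elasticity constants $c_{ij}$ ($ij\in C$). These variables are partitioned into internal parameters $x\in X\cong\mathbb{C}^{m_1}$ and control parameters $y\in Y\cong\mathbb{C}^{m_2}$. Let $\Omega\subset Y$ be an affine subvariety with real part $\Omega_\mathbb{R}$, assumed to have the same dimension as $\Omega$. Introduce variables $\delta_{ij}$ ($ij\in C$) and $\lambda_{ij}$ ($ij\in E$). Set $g_{ij}=\ell_{ij}^2-\sum_{k}(p_{ik}-p_{jk})^2$ for $ij\in B$ and $g_{ij}=\delta_{ij}^2-\sum_k(p_{ik}-p_{jk})^2$ for $ij\in C$; let $\widetilde Q_y=\sum_{ij\in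 C}\tfrac12 c_{ij}(\delta_{ij}-r_{ij})^2$ and the Lagrangian $L_y(x,\delta,\lambda)=\widetilde Q_y+\sum_{ij\in E}\lambda_{ij}g_{ij}(x,\delta,y)$. It is assumed that for each $y$ the variety $\{(x,\delta):g(x,\delta,y)=0\}$ is a complete intersection. Let $dL_y$ be the polynomial map whose components are all partial derivatives of $L_y$ with respect to $x,\delta,\lambda$, let $\mathcal{L}_y=dL_y^{-1}(0)$, and $\mathcal{LC}=\{(x,\delta,\lambda,y): y\in\Omega,\ (x,\delta,\lambda)\in\mathcal{L}_y\}$, with $\mathcal{LC}_{reg}$ its (open dense) set of smooth points, $\mathcal{LC}_{sing}$ its singular locus, and $\mathcal{LC}_\mathbb{R}$ its real points. Let $\pi:\mathcal{LC}\to\Omega$, $(x,\delta,\lambda,y)\mapsto y$. The catastrophe discriminant $\mathcal{D}_\Omega\subset\Omega$ is the Zariski closure of the set of critical values of $\pi$, i.e. of points $\pi(z)$ with $z\in\mathcal{LC}_{sing}$ or with some nonzero tangent vector $v\in T_z\mathcal{LC}$ in the kernel of $d\pi_z$. Strict local minimum: let $d^2\widetilde Q$ and $d^2g_{ij}$ be the Hessians of $\widetilde Q_y$ and $g_{ij}$ with respect to the variables $(x,\delta)$, and $dg$ the Jacobian of $g=(g_{ij})_{ij\in E}$ with respect to $(x,\delta)$. A point $z=(x,\delta,\lambda,y)\in\mathcal{LC}_\mathbb{R}$ is called a strict local minimum if the projected Hessian $V^T\big[d^2\widetilde Q+\sum_{ij\in E}\lambda_{ij}d^2g_{ij}\big]V$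 is positive definite, where $V$ is a matrix whose columns form a real basis of the null space of $dg$ at $(x,\delta)$.
   Formalization: The smooth lifting z on [0,1] is assumed rather than deduced from y(t) avoiding the discriminant: such a lifting can fail to exist, as the multipliers may tend to infinity when a cable length δ tends to 0; the claim is proved for every smooth lifting. *)

(* Defs.v *)
From HB Require Import structures.
From mathcomp Require Import all_boot all_order all_algebra.
From mathcomp Require Import mpoly.
From mathcomp Require Import all_classical all_reals all_analysis.
From mathcomp Require Import complex.

Set Implicit Arguments.
Unset Strict Implicit.
Unset Printing Implicit Defensive.

Import Order.TTheory GRing.Theory Num.Theory.
Local Open Scope ring_scope.

(* Framework variables: p_{ik} (i < n, k < d), bar lengths l_b (b < nb),    *)
(* cable resting lengths r_c and elasticity constants c_c (c < nc).         *)

Definition fvar (n d nb nc : nat) : finType :=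
  (('I_n * 'I_d) + ('I_nb + ('I_nc + 'I_nc)))%type.

Record framework := Framework {
  fn : nat;          (* number of nodes *)
  fd : nat;          (* dimension of the embedding *)
  fnb : nat;         (* number of bars *)
  fnc : nat;         (* number of cables *)
  bar_ends : 'I_fnb -> 'I_fn * 'I_fn;
  cab_ends : 'I_fnc -> 'I_fn * 'I_fn;
  ctrl : pred (fvar fn fd fnb fnc)      (* control parameters y; the others
                                           are the internal parameters x *)
}.

Section Framework.
Variable R : realType.
Variable F : framework.

Local Notation n := (fn F).
Local Notation d := (fd F).
Local Notation nb := (fnb F).
Local Notation nc := (fnc F).
Local Notation C := (R[i]).

Definition FVar := fvar n d nb nc.
Definition vP (i : 'I_n) (k : 'I_d) : FVar := inl (i, k).
Definition vL (b : 'I_nb) : FVar := inr (inl b).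
Definition vR (c : 'I_nc) : FVar := inr (inr (inl c)).
Definition vC (c : 'I_nc) : FVar := inr (inr (inr c)).

Definition edge : finType := ('I_nb + 'I_nc)%type.
Definition ends (e : edge) : 'I_n * 'I_n :=
  match e with inl b => @bar_ends F b | inr c => @cab_ends F c end.

Definition wf_graph : Prop :=
  (forall e, (ends e).1 != (ends e).2) /\
  injective (fun e => [set (ends e).1; (ends e).2]).

(* All coordinates of the ambient space of LC:
   framework variables (x and y), delta_c (c in C), lambda_e (e in E). *)
Definition AVar : finType := (FVar + ('I_nc + ('I_nb + 'I_nc)))%type.
Definition aF (v : FVar) : AVar := inl v.
Definition aD (c : 'I_nc) : AVar := inr (inl c).
Definition aLam (e : edge) : AVar :=
  match e with inl b => inr (inr (inl b)) | inr c => inr (inr (inr c)) end.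

Definition isxd (a : AVar) : bool :=
  match a with inl v => ~~ @ctrl F v | inr (inl _) => true | _ => false end.
Definition isint (a : AVar) : bool :=
  match a with inl v => ~~ @ctrl F v | inr _ => true end.

Definition K := #|{: AVar}|.
Definition pt (m : nat) := 'I_m -> C.
Local Notation Poly := (mpoly.mpoly K C).

Definition Xv (a : AVar) : Poly := @mpoly.mpolyX K C (mpoly.mnm1 (enum_rank a)).
Definition acoord (w : pt K) (a : AVar) : C := w (enum_rank a).
Definition dpoly (a : AVar) (p : Poly) : Poly := mpoly.mderiv (enum_rank a) p.
Definition ev (w : pt K) (p : Poly) : C := mpoly.meval w p.

Definition dist2 (i j : 'I_n) : Poly :=
  \sum_(k < d) (Xv (aF (vP i k)) - Xv (aF (vP j k))) ^+ 2.

Definition gpoly (e : edge) : Poly :=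
  match e with
  | inl b => Xv (aF (vL b)) ^+ 2 - dist2 (@bar_ends F b).1 (@bar_ends F b).2
  | inr c => Xv (aD c) ^+ 2 - dist2 (@cab_ends F c).1 (@cab_ends F c).2
  end.

Definition Qpoly : Poly :=
  \sum_(c < nc) @mpoly.mpolyC K C (2%:R^-1 : C) * Xv (aF (vC c))
                * (Xv (aD c) - Xv (aF (vR c))) ^+ 2.

Definition Lpoly : Poly := Qpoly + \sum_(e : edge) Xv (aLam e) * gpoly e.

Definition CVar : finType := {v : FVar | @ctrl F v}.
Definition m2 := #|{: CVar}|.
Definition piLC (w : pt K) : pt m2 :=
  fun j => acoord w (aF (val (enum_val j))).

Section AG.
Variable m : nat.

Definition vanish (S : set (pt m)) (f : mpoly.mpoly m C) :=
  forall w, S w -> mpoly.meval w f = 0.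
Definition zcl (S : set (pt m)) : set (pt m) :=
  fun w => forall f, vanish S f -> mpoly.meval w f = 0.
Definition zclosed (S : set (pt m)) := forall w, zcl S w -> S w.
Definition irred (S : set (pt m)) :=
  [/\ zclosed S, exists w, S w &
      forall A B : set (pt m), zclosed A -> zclosed B ->
        (forall w, S w -> A w \/ B w) ->
        (forall w, S w -> A w) \/ (forall w, S w -> B w)].
Definition ldim_ge (X : set (pt m)) (z : pt m) (k : nat) :=
  exists Z : nat -> set (pt m),
    [/\ forall i, (i <= k)%N -> irred (Z i),
        Z 0%N z,
        forall i, (i < k)%N ->
           (forall w, Z i w -> Z i.+1 w) /\ (exists w, Z i.+1 w /\ ~ Z i w)
      & forall w, Z k w -> X w].
Definition dim_ge (X : set (pt m)) (k : nat) := exists z, X z /\ ldim_ge X z k.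
Definition tangent (X : set (pt m)) (z : pt m) : set (pt m) :=
  fun v => forall f, vanish X f ->
    \sum_(i < m) mpoly.meval z (mpoly.mderiv i f) * v i = 0.
Definition indep_ge (S : set (pt m)) (k : nat) :=
  exists v : 'I_k -> pt m, (forall j, S (v j)) /\
    forall c : 'I_k -> C, (forall i, \sum_(j < k) c j * v j i = 0) ->
      forall j, c j = 0.
Definition reg_point (X : set (pt m)) (z : pt m) :=
  X z /\ forall k, indep_ge (tangent X z) k <-> ldim_ge X z k.
Definition isreal (w : pt m) := forall i, w i \is Num.real.
End AG.

Definition same_tdim m m' (X : set (pt m)) z (X' : set (pt m')) z' :=
  forall k, indep_ge (tangent X z) k <-> indep_ge (tangent X' z') k.

Section LC.
Variable Om : set (pt m2).

Definition LC : set (pt K) :=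
  fun w => Om (piLC w) /\ forall a, isint a -> ev w (dpoly a Lpoly) = 0.

Definition critical (w : pt K) :=
  LC w /\
  (~ reg_point LC w \/
   exists v, [/\ tangent LC w v, exists i, v i != 0 & forall j, piLC v j = 0]).

Definition critval : set (pt m2) := fun y => exists w, critical w /\ piLC w = y.
Definition discriminant : set (pt m2) := zcl critval.

Definition OmR : set (pt m2) := fun y => Om y /\ isreal y.

Definition hess (w : pt K) (a b : AVar) : C :=
  ev w (dpoly a (dpoly b Qpoly)) +
  \sum_(e : edge) acoord w (aLam e) * ev w (dpoly a (dpoly b (gpoly e))).

Definition xdvec (u : pt K) := forall a, ~~ isxd a -> acoord u a = 0.
Definition null_dg (w : pt K) (u : pt K) :=
  forall e : edge,
    \sum_(a : AVar | isxd a) ev w (dpoly a (gpoly e)) * acoord u a = 0.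

Definition realcoefs k (c : 'I_k -> C) := forall j, c j \is Num.real.

Definition strict_local_min (w : pt K) :=
  [/\ LC w, isreal w &
   exists k (V : 'I_k -> pt K),
     [/\ forall j, isreal (V j) /\ xdvec (V j),
         forall c, realcoefs c ->
           (forall i, \sum_(j < k) c j * V j i = 0) -> forall j, c j = 0,
         forall u, isreal u -> xdvec u ->
           (null_dg w u <->
            exists c, realcoefs c /\ forall i, u i = \sum_(j < k) c j * V j i)
       &
         forall c, realcoefs c -> (exists j, c j != 0) ->
           0 < \sum_(j < k) \sum_(l < k)
                 c j * (\sum_(a : AVar | isxd a) \sum_(b : AVar | isxd b)
                          acoord (V j) a * hess w a b * acoord (V l) b) * c l]].
End LC.

Definition XDVar : finType := {a : AVar | isxd a}.
Definition mxd := #|{: XDVar}|.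

Definition ycoord (y : pt m2) (v : FVar) : C :=
  if insub v is Some cv then y (enum_rank (cv : CVar)) else 0.
Definition xdcoord (u : pt mxd) (a : AVar) : C :=
  if insub a is Some s then u (enum_rank (s : XDVar)) else 0.
(* the point with (x,delta) = u, y = y (lambda irrelevant, set to 0) *)
Definition combine (u : pt mxd) (y : pt m2) : pt K :=
  fun i => match enum_val i with
           | inl v => if @ctrl F v then ycoord y v else xdcoord u (inl v)
           | inr (inl c) => xdcoord u (aD c)
           | _ => 0
           end.
Definition Vg (y : pt m2) : set (pt mxd) :=
  fun u => forall e : edge, ev (combine u y) (gpoly e) = 0.
(* complete intersection: every point of V_y has local dimension
   (number of (x,delta)-variables) - |E|  (V_y pure of codimension |E|) *)
Definition complete_intersections :=
  forall y : pt m2, forall u, Vg y u ->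
    forall k, ldim_ge (Vg y) u k <-> (k + (nb + nc) <= mxd)%N.

Definition smoothR (f : R -> R) :=
  forall (k : nat) (x : R), derivable (iter k (@derive1 R R) f) x 1.
Definition realpt m (y : 'I_m -> R) : pt m := fun j => (y j)%:C%C.
Definition smooth_cpath m (z : R -> pt m) :=
  forall i, smoothR (fun t => complex.Re (z t i)) /\ smoothR (fun t => complex.Im (z t i)).

End Framework.

(* Main.v *)
Require Import Defs.
From HB Require Import structures.
From mathcomp Require Import all_boot all_order all_algebra.
From mathcomp Require Import mpoly.
From mathcomp Require Import all_classical all_reals all_analysis.
From mathcomp Require Import complex ring lra.
Import Order.TTheory GRing.Theory Num.Theory.
Local Open Scope ring_scope.

(** The obstacle is multiplicity. Noncriticality concerns the ideal of all polynomials vanishing on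
    [LC], whereas W is built from the equations dL = 0, which need not generate that ideal: a system
    such as x^2 = 0 has a noncritical solution with singular Jacobian. Invertibility of W therefore
    cannot be read off at a single point; it has to be carried over from nearby points where it is
    already known, and this is what the residue bound does.

    Omega is an arbitrary Zariski closed set, with no equations or local coordinates at hand.
    Centring at w in LC and expanding in the internal directions only turns the equations of Omega
    into constants, which are 0 at such w, so they leave every ideal membership and the remaining
    system is square. All coefficients must then be polynomial in w, since the limit is taken in
    w. *)

(** Fix the control coordinates and read dL = 0 as a square system in the
    internal coordinates, with Jacobian W (the bordered Hessian).  The point is
    that W stays invertible along the lift z(t): a strict local minimum has W
    invertible, and as long as W is invertible the lift stays real (its complex
    conjugate lies in the same fibre) and the signature on ker dg cannot change.

    Suppose z(t) tends to z0 with W(z(t)) invertible.  As z0 is not critical, there are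
    polynomials vanishing on LC whose internal gradients at z0 are the
    coordinate vectors.  By the Nullstellensatz a power of each lies in the
    ideal of dL and of the equations of Omega, so that in coordinates u centred
    at any point w of LC one gets e^k u_i^k = sum_j a_ij dL_j along the fibre,
    with a and e polynomial in w and e = 1 at z0.  The residue
    of 1 at the simple zero z(t) is 1 / det W, and by the transformation law
    it is a coefficient of det a (up to powers of e), hence bounded as z(t) tends
    to z0.  So det W(z0) is not 0. *)

Set Implicit Arguments.
Unset Strict Implicit.
Unset Printing Implicit Defensive.

(** * Residues *)

Section Residue.
Context {A : comNzRingType} {n : nat}.
Implicit Types (p q : {mpoly A[n]}) (m : 'X_{1..n}).

(** Induction along the ring structure, suited to comparing ring morphisms on constants and
    variables. *)
Lemma mpoly_rect_ring (P : {mpoly A[n]} -> Prop) :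
  (forall c, P c%:MP) -> (forall i, P 'X_i) ->
  (forall p q, P p -> P q -> P (p + q)) ->
  (forall p q, P p -> P q -> P (p * q)) -> forall p, P p.
Proof.
move=> PC PX PD PM; elim/mpolyind=> [|c m p _ _ Pp].
  by rewrite -mpolyC0; exact: PC.
apply/PD => //; rewrite -mul_mpolyC; apply/PM => //.
rewrite mpolyXE_id; elim/big_rec: _ => [|i q _ Pq].
  by rewrite -mpolyC1; exact: PC.
apply/PM => //; elim: (m i) => [|e IH].
  by rewrite expr0 -mpolyC1; exact: PC.
by rewrite exprS; apply/PM.
Qed.

Lemma mcoeff_mulXn_lt p (i : 'I_n) k m : (m i < k)%N -> (p * 'X_i ^+ k)@_m = 0.
Proof.
move=> mk; elim/mpolyind: p => [|c m' p _ _ IH]; first by rewrite mul0r mcoeff0.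
rewrite mulrDl mcoeffD IH addr0 -scalerAl mcoeffZ mpolyXn -mpolyXD mcoeffX.
case: eqP => [E|]; last by rewrite mulr0.
by move: mk; rewrite -E mnmDE mulmnE mnm1E eqxx mul1n ltnNge leq_addl.
Qed.

Lemma mcoeff_sum_mulXn_lt (J : pred 'I_n) k m (b : 'I_n -> {mpoly A[n]}) :
  (forall i, J i -> (m i < k)%N) -> (\sum_(i | J i) b i * 'X_i ^+ k)@_m = 0.
Proof.
move=> mJ; rewrite raddf_sum big1 // => i Ji; exact: mcoeff_mulXn_lt (mJ i Ji).
Qed.

(** Cramer's rule without division: [\det M * u l] lies in the ideal of the [v i], with explicit
    coefficients. *)
Lemma det_mul_eq_adj_sum (M : 'M[{mpoly A[n]}]_n) (u v : 'I_n -> {mpoly A[n]}) :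
  (forall i, \sum_l M i l * u l = v i) ->
  forall l, \det M * u l = \sum_i (\adj M) l i * v i.
Proof.
move=> Mu l; have /matrixP/(_ l 0) := congr1 (mulmx ^~ (\col_l u l)) (mul_adj_mx M).
rewrite -mulmxA mul_scalar_mx !mxE => <-.
apply: eq_bigr => i _; rewrite !mxE -Mu; congr (_ * _).
by apply: eq_bigr => j _; rewrite !mxE.
Qed.

(** In the convolution at m, every pair other than (m, 0) takes its first factor at a proper divisor
    of m, where p has no coefficient. *)
Lemma mcoeffM_low p q m :
  (forall h : 'X_{1..n}, (forall i, (h i <= m i)%N) -> h != m -> p@_h = 0) ->
  (p * q)@_m = p@_m * q@_0%MM.
Proof.
move=> plow; rewrite -[q in LHS](subrK (q@_0%MM)%:MP) mulrDr mcoeffD.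
rewrite [p * _%:MP]mulrC mcoeffCM [X in _ + X]mulrC mcoeffM big1 ?add0r // => -[h1 h2] /= /eqP.
move: (bmnm h1) (bmnm h2) => {}h1 {}h2 E.
have [->|h2n] := eqVneq h2 0%MM.
  by rewrite mcoeffB mcoeffC eqxx mulr1 subrr mulr0.
rewrite plow ?mul0r // => [i|]; first by rewrite E mnmDE leq_addr.
by apply: contra h2n => /eqP h1m; move/eqP: E; rewrite h1m -{1}[m]addm0 eqm_add2l eq_sym.
Qed.

(** The socle monomial of the quotient by all ['X_i ^+ k.+1]; the coefficient there is the residue
    functional of that monomial system. *)
Definition topmon (k : nat) : 'X_{1..n} := [multinom k | _ < n].

Lemma topmonE k i : topmon k i = k. Proof. by rewrite mnmE. Qed.

(* Replacing one row of M at a time changes det M by a determinant d whose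
   product with 'X_i lies in the ideal of the 'X_j ^+ k.+1 with j != i. *)
Lemma mcoeff_det_topmon (M M' : 'M[{mpoly A[n]}]_n) (e : {mpoly A[n]}) k :
  (forall i, \sum_l M i l * 'X_l = e * 'X_i ^+ k.+1) ->
  (forall i, \sum_l M' i l * 'X_l = e * 'X_i ^+ k.+1) ->
  (\det M)@_(topmon k) = (\det M')@_(topmon k).
Proof.
move=> MX M'X.
pose H s := \matrix_(i, j) (if (i < s)%N then M i j else M' i j).
have HX s i : \sum_l H s i l * 'X_l = e * 'X_i ^+ k.+1.
  rewrite -[RHS](if_same (i < s)%N) -{1}MX -M'X.
  by case: ifP => si; apply: eq_bigr => l _; rewrite !mxE si.
suff HS s : (s <= n)%N -> (\det (H s))@_(topmon k) = (\det M')@_(topmon k).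
  rewrite -(HS n) //; congr (mcoeff _ (\det _)).
  by apply/matrixP => i j; rewrite !mxE ltn_ord.
elim: s => [_|s IH sn].
  by congr (mcoeff _ (\det _)); apply/matrixP => i j; rewrite !mxE.
rewrite -IH ?(ltnW sn) //; apply/eqP; rewrite -subr_eq0 -mcoeffB; apply/eqP.
pose i0 := Ordinal sn.
pose N := \matrix_(i, j) (if i == i0 then M i j - M' i j else H s i j).
have dN : \det N = \det (H s.+1) - \det (H s).
  have -> : \det N = 1 * \det (H s.+1) + (-1) * \det (H s).
    apply: (determinant_multilinear (i0 := i0)).
    - apply/rowP => j; rewrite !mxE eqxx ltnSn ltnn.
      by rewrite mul1r mulN1r.
    - apply/matrixP => i j; rewrite !mxE eq_sym (negbTE (neq_lift _ _)).
      have := neq_lift i0 i; rewrite -val_eqE /= => ne.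
      by rewrite ltnS leq_eqVlt eq_sym (negbTE ne).
    - by apply/matrixP => i j; rewrite !mxE eq_sym (negbTE (neq_lift _ _)).
  by rewrite mul1r mulN1r.
have NX i : \sum_l N i l * 'X_l = if i == i0 then 0 else e * 'X_i ^+ k.+1.
  case: ifP => [/eqP->|ii].
    rewrite -[RHS](subrr (e * 'X_i0 ^+ k.+1)) -{1}MX -M'X -sumrB.
    by apply: eq_bigr => l _; rewrite !mxE eqxx mulrBl.
  by rewrite -(HX s); apply: eq_bigr => l _; rewrite !mxE ii.
(* After multiplication by ['X_i0] the monomial still has exponent k away from i0, too small for any
   of the remaining generators ['X_i ^+ k.+1]. *)
rewrite -dN -(mcoeffMX _ U_(i0)) (det_mul_eq_adj_sum NX).
rewrite (bigD1 i0) //= eqxx mulr0 add0r.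
rewrite (eq_bigr (fun i => ((\adj N) i0 i * e) * 'X_i ^+ k.+1)); last first.
  by move=> i ii; rewrite (negbTE ii) mulrA.
apply: mcoeff_sum_mulXn_lt => i ii.
by rewrite mnmDE topmonE mnm1E eq_sym (negbTE ii) add0n.
Qed.

(* Transformation law for residues at a simple zero: the Grothendieck residue
   of 1 at the origin is 1/\det P(0) for the system P X, and is the coefficient
   of \det a at [topmon k] (up to the unit e) for the system 'X_i ^+ k.+1. *)
Lemma residue_transformation (P a : 'M[{mpoly A[n]}]_n) (e : {mpoly A[n]}) k :
  (forall i, \sum_l (a *m P) i l * 'X_l = e * 'X_i ^+ k.+1) ->
  GRing.lreg (\det P)@_0%MM ->
  (\det P)@_0%MM * (\det a)@_(topmon k) = e@_0%MM ^+ n.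
Proof.
move=> aPX Preg; set dP := \det P; set da := \det a.
(* Since [m l < k], multiplying by ['X_l] keeps the monomial within exponents at most k, which no
   element of the ideal of the ['X_i ^+ k.+1] reaches. *)
have daX l m : (m l < k)%N -> (forall i, (m i <= k)%N) -> (da * dP)@_m = 0.
  move=> mlk mk; rewrite -(mcoeffMX _ U_(l)) -det_mulmx.
  rewrite (det_mul_eq_adj_sum aPX).
  rewrite (eq_bigr (fun i => ((\adj (a *m P)) l i * e) * 'X_i ^+ k.+1)); last first.
    by move=> i _; rewrite mulrA.
  apply: mcoeff_sum_mulXn_lt => i _; rewrite mnmDE mnm1E ltnS.
  by case: eqP => [<-|_]; rewrite ?add1n ?add0n.
(* Induction on the degree: once [da] is known to vanish below m, the coefficient of [da * dP] at m
   is [da@_m] times the regular constant term of [dP]. *)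
have da0 m : (forall i, (m i <= k)%N) -> m != topmon k -> da@_m = 0.
  have [d] := ubnP (mdeg m); elim: d m => // d IH m md mk mt.
  have [l mlk] : exists l, (m l < k)%N.
    apply/existsP; apply: contraNT mt => /existsPn mge.
    apply/eqP/mnmP => i; rewrite topmonE; apply/eqP.
    by rewrite eqn_leq mk leqNgt mge.
  have := daX l m mlk mk; rewrite mcoeffM_low => [|h hm hneq].
    by rewrite mulrC => hda; apply: Preg; rewrite mulr0.
  apply: IH => [|i|]; last by apply: contraNneq hneq => ht; apply/eqP/mnmP => i;
    apply/eqP; rewrite eqn_leq hm ht topmonE mk.
  - have E : m = (h + (m - h))%MM by apply/mnmP => i; rewrite !mnmE subnKC.
    have hm0 : (m - h)%MM != 0%MM.
      by apply: contra hneq => /eqP mh0; rewrite E mh0 addm0.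
    move: md; rewrite ltnS {1}E mdegD; apply: leq_trans.
    by rewrite -addn1 leq_add2l lt0n mdeg_eq0.
  - exact: leq_trans (hm i) (mk i).
(* The diagonal matrix solves the same system as [a *m P], and its determinant is [e ^+ n] times the
   socle monomial. *)
have diagX i :
    \sum_l diag_mx (\row_i (e * 'X_i ^+ k)) i l * 'X_l = e * 'X_i ^+ k.+1.
  rewrite (bigD1 i) //= !mxE eqxx mulr1n big1 ?addr0 ?exprSr ?mulrA // => j ji.
  by rewrite !mxE eq_sym (negbTE ji) mulr0n mul0r.
have := mcoeff_det_topmon aPX diagX; rewrite det_mulmx det_diag.
rewrite mcoeffM_low => [|h hk hneq]; last first.
  by apply: da0 => // i; rewrite -(topmonE k i).
rewrite mulrC => ->; under eq_bigr do rewrite mxE.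
rewrite big_split /= prodr_const card_ord.
have -> : \prod_(i < n) 'X_i ^+ k = 'X_[topmon k] :> {mpoly A[n]}.
  by rewrite mpolyXE_id; apply: eq_bigr => i _; rewrite topmonE.
by rewrite -[X in _@_X]addm0 mcoeffMX -rmorphXn.
Qed.
End Residue.

(** * Nullstellensatz over an uncountable field *)

Section Nullstellensatz.
Local Open Scope classical_set_scope.
Local Open Scope ring_scope.
Context {K : closedFieldType} {n : nat}.
Local Notation MP := {mpoly K[n]}.
Implicit Types (p q f : MP) (I J : set MP).

Definition is_ideal I :=
  [/\ I 0, forall p q, I p -> I q -> I (p + q) & forall p q, I q -> I (p * q)].

Lemma idealB I p q : is_ideal I -> I p -> I q -> I (p - q).
Proof.
by case=> _ ID IM Ip Iq; apply: ID => //; rewrite -mulN1r; exact: IM.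
Qed.

Lemma ideal_sum I (T : Type) (r : seq T) (P : pred T) (F : T -> MP) :
  is_ideal I -> (forall i, P i -> I (F i)) -> I (\sum_(i <- r | P i) F i).
Proof. by case=> I0 ID _ IF; elim/big_ind: _. Qed.

Definition avoids f J := forall k, ~ J (f ^+ k).

(** Maximality is recorded in the form used later: adjoining any further p to M brings in a power of
    f. *)
Lemma exists_maximal_avoiding I f : is_ideal I -> avoids f I ->
  exists M, [/\ is_ideal M, avoids f M, I `<=` M &
    forall p, ~ M p -> exists k q, M (f ^+ k - q * p)].
Proof.
move=> idI avI.
(* Zorn's lemma is applied to sets whose union with [I] is an ideal, so that the empty chain, with
   empty union, is admissible. *)
have [|A [[idA avA] maxA]] :=
    @Zorn_bigcup MP (fun A => is_ideal (A `|` I) /\ avoids f (A `|` I)).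
  move=> F FP Ftot.
  have two p q : (\bigcup_(X in F) X `|` I) p -> (\bigcup_(X in F) X `|` I) q ->
      exists J, [/\ is_ideal J, J p, J q & J `<=` \bigcup_(X in F) X `|` I].
    case=> [[X FX Xp]|Ip] [[Y FY Yq]|Iq].
    - have [XY|YX] := Ftot _ _ FX FY.
        exists (Y `|` I); split; [exact: (FP _ FY).1|by left; exact: XY|by left|].
        by move=> r [Yr|]; [left; exists Y|right].
      exists (X `|` I); split; [exact: (FP _ FX).1|by left|by left; exact: YX|].
      by move=> r [Xr|]; [left; exists X|right].
    - exists (X `|` I); split; [exact: (FP _ FX).1|by left|by right|].
      by move=> r [Xr|]; [left; exists X|right].
    - exists (Y `|` I); split; [exact: (FP _ FY).1|by right|by left|].
      by move=> r [Yr|]; [left; exists Y|right].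
    - by exists I; split=> // r; right.
  split; first split.
  - by right; case: idI.
  - by move=> p q hp hq; have [J [[_ JD _] Jp Jq]] := two _ _ hp hq; apply; exact: JD.
  - by move=> p q hq; have [J [[_ _ JM] Jq _]] := two _ _ hq hq; apply; exact: JM.
  - move=> k [[X FX Xk]|]; last exact: avI.
    by apply: (FP _ FX).2 (k) _; left.
set M := A `|` I in idA avA; exists M; split => //; first by move=> p; right.
move=> p nMp; apply: contrapT => nex.
(* [B] is the ideal generated by M and p. *)
pose B := [set x | exists q, M (x - q * p)].
have MB : M `<=` B by move=> x Mx; exists 0; rewrite mul0r subr0.
have IB : B `|` I = B by apply/setUidPl => x Ix; apply: MB; right.
have [M0 MD MM] := idA.
apply: (maxA B); last first.
  rewrite IB; split; last by move=> k [q Mq]; apply: nex; exists k, q.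
  split; first exact: MB.
  - move=> x y [q Mq] [r Mr]; exists (q + r).
    by rewrite mulrDl opprD addrACA; exact: MD.
  - move=> x y [q Mq]; exists (x * q).
    by rewrite -mulrA -mulrBr; exact: MM.
split; first by move=> x Ax; apply: MB; left.
move=> BA; apply: nMp; left; apply: BA; exists 1.
by rewrite mul1r subrr.
Qed.

Lemma infinite_fiber (T : Type) (h : T -> nat) :
  ~ countable [set: T] -> exists k, infinite_set (h @^-1` [set k]).
Proof.
move=> ncT; apply: contrapT => nk; apply: ncT.
have -> : [set: T] = \bigcup_k (h @^-1` [set k]).
  by apply/seteqP; split => // x _; exists (h x).
apply: bigcup_countable => // k _; apply: finite_set_countable.
by apply: contrapT => inf; apply: nk; exists k.
Qed.

Lemma linear_dep_mpoly (N D : nat) (q : 'I_N -> MP) :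
  (forall j, (msize (q j) <= D)%N) -> (#|{: 'X_{1..n < D}}| < N)%N ->
  exists2 b : 'rV[K]_N, b != 0 & \sum_j b 0 j *: q j = 0.
Proof.
move=> qD cN; pose A := \matrix_(j < N, m < #|{: 'X_{1..n < D}}|)
  (q j)@_(enum_val m : 'X_{1..n < D}).
have : kermx A != 0.
  rewrite kermx_eq0 /row_free; apply/negP => /eqP rA.
  by have := rank_leq_col A; rewrite rA leqNgt cN.
move=> /rowV0Pn[b /sub_kermxP bA b0]; exists b => //; apply/mpolyP => m.
rewrite mcoeff0 raddf_sum /=.
have [mD|mD] := ltnP (mdeg m) D.
  have /rowP/(_ (enum_rank (BMultinom mD))) := bA; rewrite !mxE => bA0.
  rewrite -[RHS]bA0; apply: eq_bigr => j _.
  by rewrite mxE enum_rankK mcoeffZ.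
rewrite big1 // => j _; rewrite mcoeffZ memN_msupp_eq0 ?mulr0 //.
by apply: msize_mdeg_ge; apply: leq_trans mD.
Qed.

(* K being uncountable replaces Noether normalisation: otherwise the inverses
   of the 'X_i - c modulo M would be uncountably many independent polynomials. *)
Lemma maximal_avoiding_point M f : ~ countable [set: K] ->
  is_ideal M -> avoids f M ->
  (forall p, ~ M p -> exists k q, M (f ^+ k - q * p)) ->
  exists w : 'I_n -> K, forall i, M ('X_i - (w i)%:MP).
Proof.
move=> ncK idM avM maxM; have [M0 MD MM] := idM.
(* If neither factor lay in M, each would have a multiple congruent to a power of f, and the product
   of these powers would lie in M. *)
have prime p q : M (p * q) -> M p \/ M q.
  move=> Mpq; apply: contrapT => /not_orP[/maxM[k [r Mr]] /maxM[l [s Ms]]].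
  apply: (avM (k + l)%N); rewrite exprD.
  have -> : f ^+ k * f ^+ l = f ^+ l * (f ^+ k - r * p) +
      (r * p * (f ^+ l - s * q) + r * s * (p * q)) by ring.
  by apply: (MD); [exact: MM|apply: (MD); exact: MM].
suff H i : exists c, M ('X_i - c%:MP) by have [w Hw] := choice H; exists w.
apply: contrapT => /forallNP nM.
have /choice[g Mg] c : exists kq : nat * MP, M (f ^+ kq.1 - kq.2 * ('X_i - c%:MP)).
  by have [k [q]] := maxM _ (nM c); exists (k, q).
(* Modulo M, [(g c).2] is f^k / (X_i - c). Uncountability provides infinitely many c with the same
   power k of f and the same size bound, hence a linear relation among finitely many of these
   inverses. *)
have [[k D] kD] : exists kD : nat * nat,
    infinite_set [set c | (g c).1 = kD.1 /\ msize (g c).2 = kD.2].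
  have [x infx] := infinite_fiber (fun c => pickle ((g c).1, msize (g c).2)) ncK.
  have [c0 /= c0x] := infinite_setN0 infx.
  exists ((g c0).1, msize (g c0).2); apply: sub_infinite_set infx => c /=.
  by rewrite -c0x => /(pcan_inj (@pickleK _))[-> ->].
have [B BkD cardB] := infinite_set_fset (#|{: 'X_{1..n < D}}|).+1 kD.
pose N := (#|{: 'X_{1..n < D}}|).+1; pose c (j : 'I_N) := nth 0 (finmap.enum_fset B) j.
have cB j : [/\ (g (c j)).1 = k & msize (g (c j)).2 = D].
  suff /BkD[] : [set` finmap.enum_fset B] (c j) by [].
  by apply: mem_nth; apply: leq_trans cardB.
have c_inj : injective c.
  move=> j l /eqP; rewrite nth_uniq ?finmap.fset_uniq //; try by apply: leq_trans cardB.
  by move=> /eqP/val_inj.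
have [||b b0 bq] := @linear_dep_mpoly N D (fun j => (g (c j)).2).
- by move=> j; have [_ ->] := cB j.
- by [].
(* The numerator of the sum of the b_j / (X - c_j). It is nonzero because its value at c_j is b_j
   times a product of differences of distinct scalars. *)
pose p : {poly K} := \sum_j b 0 j *: \prod_(l | l != j) ('X - (c l)%:P).
have p0 : p != 0.
  have [j bj] : exists j, b 0 j != 0.
    apply/existsP; apply: contraNT b0 => /existsPn H; apply/eqP/rowP => j.
    by rewrite mxE; apply/eqP/negPn/H.
  apply: contraTneq bj => p0; have := congr1 (horner^~ (c j)) p0.
  rewrite horner0 horner_sum (bigD1 j) //= [X in _ + X]big1 ?addr0 => [|l lj]; last first.
    by rewrite hornerZ horner_prod (bigD1 j) 1?eq_sym //= hornerXsubC subrr mul0r mulr0.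
  rewrite hornerZ horner_prod => /eqP; rewrite mulf_eq0 negbK => /orP[//|/prodf_eq0[l lj]]; rewrite hornerXsubC subr_eq0.
  by move=> /eqP/c_inj jl; rewrite jl eqxx in lj.
pose ev_i (h : {poly K}) : MP := (map_poly (@mpolyC n K) h).['X_i].
have ev_iXC z : ev_i ('X - z%:P) = 'X_i - z%:MP.
  by rewrite /ev_i rmorphB /= map_polyX map_polyC hornerXsubC.
have ev_iM x y : ev_i (x * y) = ev_i x * ev_i y by rewrite /ev_i rmorphM hornerM.
have ev_iZ a x : ev_i (a *: x) = a%:MP * ev_i x.
  by rewrite /ev_i -mul_polyC rmorphM hornerM /= map_polyC hornerC.
have ev_i1 : ev_i 1 = 1 by rewrite /ev_i rmorph1 hornerC.
have ev_i_prod (r : seq K) : ev_i (\prod_(z <- r) ('X - z%:P)) = \prod_(z <- r) ('X_i - z%:MP).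
  by elim/big_rec2: _ => // z u v _ <-; rewrite ev_iM ev_iXC.
have ev_i_sum : ev_i p = \sum_j (b 0 j)%:MP * \prod_(l | l != j) ('X_i - (c l)%:MP).
  rewrite /ev_i /p rmorph_sum horner_sum; apply: eq_bigr => j _.
  rewrite -[LHS]/(ev_i _) ev_iZ; congr (_ * _).
  by elim/big_rec2: _ => // l u v _ <-; rewrite ev_iM ev_iXC.
have Mfp : M (f ^+ k * ev_i p).
  have -> : f ^+ k * ev_i p = \sum_j ((b 0 j)%:MP * \prod_(l | l != j) ('X_i - (c l)%:MP)
       * (f ^+ k - (g (c j)).2 * ('X_i - (c j)%:MP))).
    apply/esym; under eq_bigr do rewrite mulrBr.
    rewrite sumrB -mulr_suml -ev_i_sum [ev_i p * _]mulrC -[RHS]subr0; congr (_ - _).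
    rewrite (eq_bigr (fun j => (b 0 j *: (g (c j)).2) * \prod_l ('X_i - (c l)%:MP))).
      by rewrite -mulr_suml bq mul0r.
    by move=> j _; rewrite -mul_mpolyC [in RHS](bigD1 j) //=; ring.
  apply: ideal_sum => // j _; apply: MM; have [<- _] := cB j.
  exact: Mg.
have {Mfp} Mp : M (ev_i p) by have [/avM|] := prime _ _ Mfp.
(* As p splits into linear factors and M is prime, M would contain a nonzero constant or some X_i -
   z, and both are excluded. *)
have [r pE] := closed_field_poly_normal p; rewrite pE ev_iZ ev_i_prod in Mp.
have unit_notin (a : K) : a != 0 -> ~ M a%:MP.
  move=> a0 /(MM (a^-1)%:MP); rewrite -mpolyCM mulVf // mpolyC1 -(expr0 f).
  exact: avM.
have {Mp} [/unit_notin|] := prime _ _ Mp; first by apply; rewrite lead_coef_eq0.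
elim: r {pE} => [|z r IH]; first by rewrite big_nil -mpolyC1; apply: unit_notin; rewrite oner_eq0.
by rewrite big_cons => /prime[/nM|/IH].
Qed.

(** Avoiding the powers of f from the outset takes the place of Rabinowitsch's extra variable: M
    turns out to be the ideal of a point of the zero set of I, where f vanishes, so f would lie in
    M. *)
Theorem nullstellensatz I f : ~ countable [set: K] -> is_ideal I ->
  (forall w : 'I_n -> K, (forall p, I p -> p.@[w] = 0) -> f.@[w] = 0) ->
  exists k, I (f ^+ k).
Proof.
move=> ncK idI Vf; apply: contrapT => /forallNP avI.
have [M [idM avM IM maxM]] := exists_maximal_avoiding idI avI.
have [w Mw] := maximal_avoiding_point ncK idM avM maxM.
have [M0 MD MM] := idM.
have Mev p : M (p - (p.@[w])%:MP).
  elim/(@mpoly_rect_ring K n): p => [c|i|p q Mp Mq|p q Mp Mq].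
  - by rewrite mevalC subrr.
  - by rewrite mevalXU.
  - by rewrite mevalD mpolyCD opprD addrACA; apply: MD.
  - have -> : p * q - ((p * q).@[w])%:MP =
        q * (p - (p.@[w])%:MP) + (p.@[w])%:MP * (q - (q.@[w])%:MP).
      by rewrite mevalM mpolyCM; ring.
    by apply: MD; apply: MM.
have Mconst c : M c%:MP -> c = 0.
  move=> Mc; apply: contrapT => /eqP c0; apply: (avM 0%N).
  by rewrite expr0 -mpolyC1 -(mulVf c0) mpolyCM; exact: MM.
apply: (avM 1%N); rewrite expr1 -[f](subrK (f.@[w])%:MP); apply: MD => //.
rewrite Vf ?mpolyC0 // => p /IM Mp; apply: Mconst.
by rewrite -[_%:MP](subKr p); apply: idealB.
Qed.
End Nullstellensatz.

Lemma uncountable_real (R : realType) : ~ countable [set: R]%classic.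
Proof.
move=> cR; have /countable_lebesgue_measure0 : countable `[0%R : R, 1%R]%classic.
  by apply: sub_countable cR; exact: subset_card_le.
rewrite lebesgue_measure_itv /= lte_fin ltr01 sube0 => /eqP.
by rewrite eqe oner_eq0.
Qed.

Lemma uncountable_complex (R : realType) : ~ countable [set: R[i]]%classic.
Proof.
move=> /countable_injP[f fi]; apply: (@uncountable_real R).
apply/countable_injP; exists (fun x => f (x%:C)%C) => x y _ _ /fi.
by rewrite !in_setT => /(_ isT isT)[].
Qed.

(** * Polynomial families of polynomials *)

(** Double annihilator for a subspace given only as a predicate. A free family in D of maximal size
    spans it, and the columns of the cokernel of that family serve as the test vectors v. *)
Lemma span_of_annihilator (F : fieldType) n (D : set 'rV[F]_n) (e : 'rV[F]_n) :
  D 0 -> (forall u v, D u -> D v -> D (u + v)) -> (forall a u, D u -> D (a *: u)) ->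
  (forall v : 'cV[F]_n, (forall d, D d -> d *m v = 0) -> e *m v = 0) -> D e.
Proof.
move=> D0 DD DZ De.
pose P k := `[< exists B : 'M[F]_(k, n), row_free B /\ forall i, D (row i B) >].
have P0 : P 0%N.
  apply/asboolP; exists 0; split; last by case.
  by rewrite /row_free mxrank0.
have Pn k : P k -> (k <= n)%N.
  by move=> /asboolP[B [/eqP rB _]]; have := rank_leq_col B; rewrite rB.
case: (ex_maxnP (ex_intro P 0%N P0) Pn) => k /asboolP[B [Bfree DB]] kmax.
have DsubB d : D d -> (d <= B)%MS.
  move=> Dd; apply: contraT => dB; suff : (k + 1 <= k)%N by rewrite addn1 ltnn.
  apply: kmax.
  apply/asboolP; exists (col_mx B d); split; last first.
    move=> i; case: (split_ordP i) => j ->; rewrite ?rowKu ?rowKd //.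
    by rewrite ord1 (_ : row 0 d = d) //; apply/rowP => l; rewrite mxE.
  rewrite /row_free eqn_leq rank_leq_row /= (_ : \rank (col_mx B d) = \rank (B + d)%MS); last by rewrite addsmxE.
  rewrite addn1 -[X in (X < _)%N](eqP Bfree).
  by apply: rank_ltmx; rewrite ltmxE addsmxSl addsmx_sub submx_refl.
have /submxP[u ->] : (e <= B)%MS.
  rewrite submxE; apply/eqP/matrixP => i j; rewrite [RHS]mxE.
  have colM (d : 'rV_n) : d *m col j (cokermx B) = col j (d *m cokermx B).
    by apply/matrixP => a b; rewrite !mxE; apply: eq_bigr => l _; rewrite mxE.
  have /matrixP/(_ i 0) : e *m col j (cokermx B) = 0; last by rewrite colM !mxE.
  apply: De => d /DsubB; rewrite submxE colM => /eqP->.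
  by apply/colP => l; rewrite !mxE.
rewrite mulmx_sum_row; elim/big_ind: _ => // i _; exact: DZ.
Qed.

Section Coefficients.
Context {A : comNzRingType} {n : nat}.
Implicit Types (p q : {mpoly A[n]}).

Lemma mpoly_split p : exists N : 'I_n -> {mpoly A[n]},
  p = (p@_0%MM)%:MP + \sum_b N b * 'X_b.
Proof.
elim/(@mpoly_rect_ring A n): p => [c|i|p q [N pE] [M qE]|p q [N pE] [M qE]].
- exists (fun=> 0); rewrite mcoeffC eqxx mulr1 big1 ?addr0 // => b _.
  by rewrite mul0r.
- exists (fun b => (i == b)%:R); rewrite mcoeffX mnm1_eq0 mpolyC0 add0r.
  rewrite (bigD1 i) //= eqxx mul1r big1 ?addr0 // => b bi.
  by rewrite eq_sym (negbTE bi) mul0r.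
- exists (fun b => N b + M b); rewrite {1}pE {1}qE mcoeffD mpolyCD addrACA.
  by rewrite -big_split /=; under [in RHS]eq_bigr do rewrite mulrDl.
- exists (fun b => (p@_0%MM)%:MP * M b + N b * q).
  rewrite (_ : (p * q)@_0%MM = p@_0%MM * q@_0%MM); last exact: rmorphM.
  under eq_bigr => b _ do rewrite mulrDl -mulrA [_ * q * _]mulrAC.
  rewrite big_split /= -mulr_sumr -mulr_suml addrA mpolyCM -mulrDr -qE.
  by rewrite -mulrDl -pE.
Qed.

Lemma mcoeff_sum_mulX (N : 'I_n -> {mpoly A[n]}) c :
  (\sum_b N b * 'X_b)@_U_(c) = (N c)@_0%MM.
Proof.
rewrite raddf_sum (bigD1 c) //= big1 ?addr0 => [|b bc].
  by have := mcoeffMX (N c) U_(c) 0%MM; rewrite addm0.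
by rewrite -['X_b]expr1 mcoeff_mulXn_lt // mnm1E eq_sym (negbTE bc).
Qed.

Lemma meval_at0 p : p.@[fun=> 0] = p@_0%MM.
Proof.
elim/(@mpoly_rect_ring A n): p => [c|i|p q pp pq|p q pp pq].
- by rewrite mevalC mcoeffC eqxx mulr1.
- by rewrite mevalXU mcoeffX mnm1_eq0.
- by rewrite mevalD mcoeffD pp pq.
- by rewrite mevalM (rmorphM (mcoeff 0%MM)) pp pq.
Qed.

Lemma mderivXU i j : 'X_j^`M(i) = (i == j)%:R :> {mpoly A[n]}.
Proof.
rewrite mderivX mnm1E eq_sym; case: eqVneq => [->|_]; last by rewrite scale0r.
rewrite (_ : U_(j) - U_(j) = 0)%MM ?mpolyX0 ?scale1r //.
by apply/mnmP => l; rewrite mnmE subnn mnm0E.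
Qed.

Lemma mcoeffU_mderiv p i : p@_U_(i) = (p^`M(i))@_0%MM.
Proof. by rewrite mcoeff_mderiv mnm0E add0m mulr1n. Qed.

Lemma mcoeffU_M p q i :
  (p * q)@_U_(i) = p@_U_(i) * q@_0%MM + p@_0%MM * q@_U_(i).
Proof. by rewrite !mcoeffU_mderiv mderivM mcoeffD !(rmorphM (mcoeff 0%MM)). Qed.
End Coefficients.

Section PolynomialFamilies.
Context {C : comNzRingType} {n : nat}.
Local Notation pnt := ('I_n -> C).
Local Notation MP := {mpoly C[n]}.
Implicit Types (q : pnt -> MP).

(** The coefficients depend polynomially on the base point. A single polynomial over polynomials
    expresses this, so extracting a coefficient yields a polynomial in w, as in [polyfam_mcoeff]. *)
Definition polyfam q :=
  exists Q : {mpoly MP[n]}, forall w, q w = map_mpoly (meval w) Q.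

Lemma polyfam_cst p : polyfam (fun=> p).
Proof.
exists (map_mpoly (@mpolyC n C) p) => w; apply/mpolyP => m.
by rewrite !mcoeff_map_mpoly /= mevalC.
Qed.

Lemma polyfam_ev p : polyfam (fun w => (p.@[w])%:MP).
Proof. by exists p%:MP => w; rewrite map_mpolyC. Qed.

Lemma polyfamD q1 q2 : polyfam q1 -> polyfam q2 -> polyfam (fun w => q1 w + q2 w).
Proof. by move=> [Q1 h1] [Q2 h2]; exists (Q1 + Q2) => w; rewrite rmorphD h1 h2. Qed.

Lemma polyfamM q1 q2 : polyfam q1 -> polyfam q2 -> polyfam (fun w => q1 w * q2 w).
Proof. by move=> [Q1 h1] [Q2 h2]; exists (Q1 * Q2) => w; rewrite rmorphM h1 h2. Qed.

Lemma polyfamX q k : polyfam q -> polyfam (fun w => q w ^+ k).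
Proof. by move=> [Q hQ]; exists (Q ^+ k) => w; rewrite rmorphXn /= hQ. Qed.

Lemma polyfam_sum (I : finType) (P : pred I) (q : I -> pnt -> MP) :
  (forall i, polyfam (q i)) -> polyfam (fun w => \sum_(i | P i) q i w).
Proof.
move=> /choice[Q hQ]; exists (\sum_(i | P i) Q i) => w.
by rewrite rmorph_sum; apply: eq_bigr => i _; rewrite hQ.
Qed.

Lemma polyfam_det k (M : 'I_k -> 'I_k -> pnt -> MP) :
  (forall i j, polyfam (M i j)) -> polyfam (fun w => \det (\matrix_(i, j) M i j w)).
Proof.
move=> pM; have /choice[Q hQ] i : exists Qi, forall j w, M i j w = map_mpoly (meval w) (Qi j).
  by have /choice[Qi hQi] := pM i; exists Qi.
exists (\det (\matrix_(i, j) Q i j)) => w.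
rewrite -det_map_mx; congr (\det _).
by apply/matrixP => i j; rewrite !mxE hQ.
Qed.

Lemma polyfam_adj k (M : 'I_k -> 'I_k -> pnt -> MP) i j :
  (forall i j, polyfam (M i j)) ->
  polyfam (fun w => (\adj (\matrix_(i, j) M i j w)) i j).
Proof.
move=> pM; pose M' a b := M (lift j a) (lift i b).
have [Q hQ] := polyfam_det (M := M') (fun a b => pM _ _).
exists ((-1) ^+ (j + i) * Q) => w; rewrite mxE /cofactor rmorphM rmorph_sign /= -hQ.
by congr (_ * \det _); apply/matrixP => a b; rewrite !mxE.
Qed.

Lemma polyfam_mcoeff q m : polyfam q -> exists p : MP, forall w, (q w)@_m = p.@[w].
Proof. by move=> [Q hQ]; exists (Q@_m) => w; rewrite hQ mcoeff_map_mpoly. Qed.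

Lemma polyfam_split q : polyfam q -> exists N : 'I_n -> pnt -> MP,
  [/\ forall b, polyfam (N b),
      forall w, q w = ((q w)@_0%MM)%:MP + \sum_b N b w * 'X_b &
      forall w b, (N b w)@_0%MM = (q w)@_U_(b)].
Proof.
move=> [Q hQ]; have [N QE] := mpoly_split Q.
pose M b w := map_mpoly (meval w) (N b).
suff ME w : q w = ((q w)@_0%MM)%:MP + \sum_b M b w * 'X_b.
  exists M; split=> [b|//|w b]; first by exists (N b).
  rewrite [in RHS]ME mcoeffD mcoeffC mnm1_eq0 mulr0 add0r.
  by rewrite (mcoeff_sum_mulX (M ^~ w)).
rewrite hQ [in LHS]QE rmorphD /= map_mpolyC mcoeff_map_mpoly; congr (_ + _).
by rewrite rmorph_sum; apply: eq_bigr => b _; rewrite rmorphM /= map_mpolyX.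
Qed.

Context (free : pred 'I_n).

(** Taylor expansion at w along the fibre: the non-free coordinates are frozen at their values at
    w. *)
Definition translate (w : pnt) : MP -> MP :=
  mmap (@mpolyC n C) (fun i => (if free i then 'X_i else 0) + (w i)%:MP).
HB.instance Definition _ w := GRing.RMorphism.copy (translate w)
  (mmap (@mpolyC n C) (fun i => (if free i then 'X_i else 0) + (w i)%:MP)).

Lemma translateC w c : translate w c%:MP = c%:MP.
Proof. by rewrite /translate mmapC. Qed.

Lemma translateXU w i : translate w 'X_i = (if free i then 'X_i else 0) + (w i)%:MP.
Proof. by rewrite /translate mmapX mmap1U. Qed.

Lemma translateD w (p q : MP) : translate w (p + q) = translate w p + translate w q.
Proof. exact: rmorphD. Qed.

Lemma translateM w (p q : MP) : translate w (p * q) = translate w p * translate w q.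
Proof. exact: rmorphM. Qed.

Lemma polyfam_translate p : polyfam (translate ^~ p).
Proof.
elim/(@mpoly_rect_ring C n): p => [c|i|p q pp pq|p q pp pq].
- have [Q hQ] := polyfam_cst c%:MP; exists Q => w; rewrite translateC; exact: hQ.
- have [Q hQ] := polyfamD (polyfam_cst (if free i then 'X_i else 0)) (polyfam_ev 'X_i).
  by exists Q => w; rewrite translateXU -hQ mevalXU.
- by have [Q hQ] := polyfamD pp pq; exists Q => w; rewrite rmorphD /= hQ.
- by have [Q hQ] := polyfamM pp pq; exists Q => w; rewrite rmorphM /= hQ.
Qed.

Lemma translate_mcoeff0 w p : (translate w p)@_0%MM = p.@[w].
Proof.
elim/(@mpoly_rect_ring C n): p => [c|i|p q pp pq|p q pp pq].
- by rewrite translateC mevalC mcoeffC eqxx mulr1.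
- rewrite translateXU mevalXU mcoeffD mcoeffC eqxx mulr1.
  by case: ifP; rewrite ?mcoeff0 ?mcoeffX ?mnm1_eq0 add0r.
- by rewrite rmorphD mcoeffD mevalD pp pq.
- by rewrite rmorphM (rmorphM (mcoeff 0%MM)) mevalM /= pp pq.
Qed.

Lemma translate_mcoeffU w p b :
  (translate w p)@_U_(b) = if free b then (p^`M(b)).@[w] else 0.
Proof.
elim/(@mpoly_rect_ring C n): p => [c|i|p q pp pq|p q pp pq].
- by rewrite translateC mcoeffC mderivC meval0 mnm1_eq0 mulr0 if_same.
- rewrite translateXU mcoeffD mcoeffC mnm1_eq0 mulr0 addr0 mderivXU rmorph_nat.
  rewrite [b == i]eq_sym; case: (eqVneq i b) => [->|ib].
    by case: ifP; rewrite ?mcoeff0 // mcoeffXU eqxx.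
  by rewrite if_same; case: ifP; rewrite ?mcoeff0 // mcoeffXU (negbTE ib).
- by rewrite rmorphD mcoeffD mderivD mevalD pp pq; case: ifP; rewrite ?addr0.
- rewrite rmorphM /= mcoeffU_M !translate_mcoeff0 pp pq mderivM mevalD !mevalM.
  by case: ifP; rewrite ?mul0r ?mulr0 ?addr0.
Qed.

Lemma translate_meval (w u : pnt) p : (forall i, ~~ free i -> u i = 0) ->
  (translate w p).@[u] = p.@[fun i => u i + w i].
Proof.
move=> u0; elim/(@mpoly_rect_ring C n): p => [c|i|p q pp pq|p q pp pq].
- by rewrite translateC !mevalC.
- rewrite translateXU mevalD mevalC mevalXU; congr (_ + _).
  by case: ifPn => [_|/u0->]; rewrite ?mevalXU ?meval0.
- by rewrite rmorphD !mevalD pp pq.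
- by rewrite rmorphM !mevalM pp pq.
Qed.
End PolynomialFamilies.

(** * Unramified points of square systems *)

Section ReducedComplete.
Local Open Scope classical_set_scope.
Local Open Scope ring_scope.
Context {C : closedFieldType} {n : nat} (free : pred 'I_n).
Local Notation pnt := ('I_n -> C).
Local Notation MP := {mpoly C[n]}.
Context (V : set pnt) (G : 'I_n -> MP) (S0 : set MP).
Implicit Types (q : pnt -> MP) (w v : pnt).

(** Using ['X_j] itself in the non-free directions makes the system square in all n variables, and
    its Jacobian determinant is that of the free block. *)
Definition system j w : MP := if free j then translate free w (G j) else 'X_j.

(** Ideal membership uniformly in w. The identity is required only for w in [V], so translated
    elements of [S0], which become 0 there, need no coefficients. *)
Definition in_sys q := exists a : 'I_n -> pnt -> MP, (forall j, polyfam (a j)) /\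
  forall w, V w -> q w = \sum_j a j w * system j w.

Definition in_radical q := polyfam q /\ exists k, in_sys (fun w => q w ^+ k).

Definition jacobian w : 'M[C]_n := \matrix_(i, j)
  if free i then (if free j then ((G i)^`M(j)).@[w] else 0) else (i == j)%:R.

Lemma in_sysD q1 q2 : in_sys q1 -> in_sys q2 -> in_sys (fun w => q1 w + q2 w).
Proof.
move=> [a [pa aE]] [b [pb bE]]; exists (fun j w => a j w + b j w); split.
  by move=> j; exact: polyfamD.
move=> w Vw; rewrite aE // bE // -big_split /=.
by apply: eq_bigr => j _; rewrite mulrDl.
Qed.

Lemma in_sysM q1 q2 : polyfam q1 -> in_sys q2 -> in_sys (fun w => q1 w * q2 w).
Proof.
move=> pq [b [pb bE]]; exists (fun j w => q1 w * b j w); split.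
  by move=> j; exact: polyfamM.
by move=> w Vw; rewrite bE // mulr_sumr; apply: eq_bigr => j _; rewrite mulrA.
Qed.

Lemma in_sys_ext q1 q2 : (forall w, V w -> q1 w = q2 w) -> in_sys q1 -> in_sys q2.
Proof. by move=> E [a [pa aE]]; exists a; split=> // w Vw; rewrite -E // aE. Qed.

Lemma in_sys0 : in_sys (fun=> 0).
Proof.
exists (fun _ _ => 0); split=> [j|w _]; first exact: polyfam_cst.
by rewrite big1 // => j _; rewrite mul0r.
Qed.

Lemma in_sys_sum (I : finType) (F : I -> pnt -> MP) :
  (forall i, in_sys (F i)) -> in_sys (fun w => \sum_i F i w).
Proof.
move=> FJ; elim: (index_enum I) => [|i r IH].
  by apply: in_sys_ext in_sys0 => w _; rewrite big_nil.
by apply: in_sys_ext (in_sysD (FJ i) IH) => w _; rewrite big_cons.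
Qed.

Lemma in_radical_sys j : in_radical (system j).
Proof.
have pj : polyfam (system j).
  rewrite /system; case: (free j); first exact: polyfam_translate.
  exact: polyfam_cst.
split=> //; exists 1%N, (fun l _ => (l == j)%:R); split=> [l|w _].
  exact: polyfam_cst.
rewrite expr1 (bigD1 j) //= eqxx mul1r big1 ?addr0 // => l lj.
by rewrite (negbTE lj) mul0r.
Qed.

Lemma in_radicalM q1 q2 : polyfam q1 -> in_radical q2 ->
  in_radical (fun w => q1 w * q2 w).
Proof.
move=> p1 [p2 [k Jk]]; split; first exact: polyfamM.
exists k; apply: in_sys_ext (in_sysM (polyfamX k p1) Jk) => w _.
by rewrite exprMn.
Qed.

Lemma in_sys_expW q k l : polyfam q -> (k <= l)%N ->
  in_sys (fun w => q w ^+ k) -> in_sys (fun w => q w ^+ l).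
Proof.
move=> pq kl Jk; apply: in_sys_ext (in_sysM (polyfamX (l - k) pq) Jk) => w _.
by rewrite -exprD subnK.
Qed.

Lemma in_radicalD q1 q2 : in_radical q1 -> in_radical q2 ->
  in_radical (fun w => q1 w + q2 w).
Proof.
move=> [p1 [k J1]] [p2 [l J2]]; split; first exact: polyfamD.
exists (k + l)%N.
apply: (@in_sys_ext (fun w => \sum_(i < (k + l).+1)
    (q1 w ^+ (k + l - i) * q2 w ^+ i) *+ 'C(k + l, i))).
  by move=> w _; rewrite exprDn.
apply: in_sys_sum => i.
apply: (@in_sys_ext (fun w => ('C(k + l, i)%:R) * (q1 w ^+ (k + l - i) * q2 w ^+ i))).
  by move=> w _; rewrite mulr_natl.
apply: in_sysM; first exact: polyfam_cst.
have [li|il] := leqP l i.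
  by apply: in_sysM (polyfamX _ p1) _; exact: in_sys_expW J2.
have Jk : in_sys (fun w => q1 w ^+ (k + l - i)).
  by apply: in_sys_expW J1 => //; rewrite -addnBA ?leq_addr // ltnW.
apply: in_sys_ext (in_sysM (polyfamX i p2) Jk) => w _; exact: mulrC.
Qed.

Lemma in_radical_sum (I : finType) (F : I -> pnt -> MP) :
  (forall i, in_radical (F i)) -> in_radical (fun w => \sum_i F i w).
Proof.
move=> FJ; split; first by apply: polyfam_sum => i; exact: (FJ i).1.
suff [_ [k Jk]] : in_radical (fun w => \sum_(i <- index_enum I) F i w) by exists k.
elim: (index_enum I) => [|i r [IHp [k IHk]]].
  split; first by have [Q hQ] := polyfam_cst (n := n) (0 : MP); exists Q => w; rewrite big_nil -(hQ w).
  by exists 1%N; apply: in_sys_ext in_sys0 => w _; rewrite big_nil expr1.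
have [[Q hQ] [l Jl]] := in_radicalD (FJ i) (conj IHp (ex_intro _ k IHk)).
split; first by exists Q => w; rewrite big_cons hQ.
by exists l; apply: in_sys_ext Jl => w _; rewrite big_cons.
Qed.

Context (uncountableC : ~ countable [set: C]).
Context (VE : forall w, V w <->
  (forall i, free i -> (G i).@[w] = 0) /\ (forall p, S0 p -> p.@[w] = 0)).
Context (translateS0 : forall p w, S0 p -> translate free w p = (p.@[w])%:MP).

(** Hadamard's lemma at all points of [V] at once: the constant terms vanish because w itself solves
    the system. *)
Lemma system_split : exists P : 'I_n -> 'I_n -> pnt -> MP,
  [/\ forall j b, polyfam (P j b),
      forall w j, V w -> \sum_b (\matrix_(j, b) P j b w) j b * 'X_b = system j w &
      forall w, (\det (\matrix_(j, b) P j b w))@_0%MM = \det (jacobian w)].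
Proof.
have /choice[P PP] j := polyfam_split (in_radical_sys j).1.
exists P; split=> [j b|w j Vw|w]; first by have [] := PP j.
  have [_ -> _] := PP j; rewrite (_ : (system j w)@_0%MM = 0).
    by rewrite mpolyC0 add0r; apply: eq_bigr => l _; rewrite mxE.
  rewrite /system; case fj: (free j); last by rewrite mcoeffX mnm1_eq0.
  by rewrite translate_mcoeff0; have /VE[/(_ j fj)] := Vw.
rewrite -det_map_mx; congr (\det _); apply/matrixP => i j; rewrite !mxE.
have [_ _ PU] := PP i; rewrite -[LHS]/((P i j w)@_0%MM) PU /system; case fi: (free i).
  by rewrite translate_mcoeffU.
by rewrite mcoeffXU.
Qed.

(* For w and w + u in V the matrix of [system_split], evaluated at u, kills u. *)
Lemma fiber_injectivity : exists Q : {mpoly MP[n]},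
  (forall w, meval (fun=> 0) (map_mpoly (meval w) Q) = \det (jacobian w)) /\
  forall w u, V w -> V (fun i => u i + w i) -> (forall i, ~~ free i -> u i = 0) ->
    forall l, (map_mpoly (meval w) Q).@[u] * u l = 0.
Proof.
have [P [pP sysP jacP]] := system_split.
have [Q QE] := polyfam_det pP; exists Q; split=> [w|w u Vw Vwu u0 l].
  by rewrite -QE meval_at0 jacP.
rewrite -QE -(mevalXU u l) -mevalM (det_mul_eq_adj_sum (sysP w ^~ Vw)) raddf_sum big1 // => i _.
rewrite /= mevalM /system; case fi: (free i); last by rewrite mevalXU u0 ?fi ?mulr0.
by rewrite translate_meval //; have /VE[->] := Vwu; rewrite ?mulr0.
Qed.

(** The polynomials whose translates satisfy [in_sys] form an ideal that contains both the [G i] and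
    [S0], so its zeros lie in [V] and the Nullstellensatz applies to it. *)
Lemma in_radical_translate (f : MP) : (forall w, V w -> f.@[w] = 0) ->
  in_radical (fun w => translate free w f).
Proof.
move=> Vf; split; first exact: polyfam_translate.
pose I : set MP := [set p | in_sys (fun w => translate free w p)].
have idI : is_ideal I.
  split; rewrite /I /=.
  - by apply: in_sys_ext in_sys0 => w _; rewrite rmorph0.
  - move=> p q Ip Iq; apply: in_sys_ext (in_sysD Ip Iq) => w _.
    by rewrite rmorphD.
  - move=> p q Iq; apply: in_sys_ext (in_sysM (polyfam_translate free p) Iq) => w _.
    by rewrite rmorphM.
have [k Ik] : exists k, I (f ^+ k).
  apply: nullstellensatz => // w Iw; apply/Vf/VE; split=> [i fi|p Sp]; apply: Iw.
    have [_ [k Jk]] := in_radical_sys i; apply: in_sys_ext (_ : in_sys (system i)).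
      by move=> w' _; rewrite /system fi.
    exists (fun l _ => (l == i)%:R); split=> [l|w' _]; first exact: polyfam_cst.
    rewrite (bigD1 i) //= eqxx mul1r big1 ?addr0 // => l lj.
    by rewrite (negbTE lj) mul0r.
  apply: in_sys_ext in_sys0 => w' /VE[_ V0].
  by rewrite translateS0 // V0 // mpolyC0.
by exists k; apply: in_sys_ext Ik => w _; rewrite rmorphXn.
Qed.

Context (z0 : pnt).
Context (unramified : forall v, (forall i, ~~ free i -> v i = 0) ->
  (forall f : MP, (forall w, V w -> f.@[w] = 0) ->
    \sum_i (f^`M(i)).@[z0] * v i = 0) -> forall i, v i = 0).

(** By [unramified], the fibre gradients at z0 of the polynomials vanishing on V have no common
    nonzero annihilator, so they span all fibre directions. *)
Lemma exists_coordinate i : free i -> exists f : MP,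
  (forall w, V w -> f.@[w] = 0) /\
  forall j, free j -> (f^`M(j)).@[z0] = (i == j)%:R.
Proof.
move=> fi.
pose grad (f : MP) : 'rV[C]_n := \row_j (if free j then (f^`M(j)).@[z0] else 0).
pose D : set 'rV[C]_n := [set u | exists f : MP,
  (forall w, V w -> f.@[w] = 0) /\ u = grad f].
suff [f [Vf fE]] : D (delta_mx 0 i).
  exists f; split=> // j fj; move/rowP/(_ j): fE.
  by rewrite !mxE eqxx /= fj eq_sym => <-.
apply: span_of_annihilator.
- exists 0; split=> [w _|]; first exact: meval0.
  by apply/rowP => j; rewrite !mxE mderiv0 meval0 if_same.
- move=> _ _ [f [Vf ->]] [g [Vg ->]]; exists (f + g); split=> [w Vw|].
    by rewrite mevalD Vf // Vg // addr0.
  by apply/rowP => j; rewrite !mxE mderivD mevalD; case: ifP; rewrite ?addr0.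
- move=> a _ [f [Vf ->]]; exists (a *: f); split=> [w Vw|].
    by rewrite mevalZ Vf // mulr0.
  by apply/rowP => j; rewrite !mxE mderivZ mevalZ; case: ifP; rewrite ?mulr0.
move=> v Dv; pose v' j := if free j then v j 0 else 0.
have v'0 : forall j, v' j = 0.
  apply: unramified => [j /negbTE nj|f Vf]; first by rewrite /v' nj.
  have /matrixP/(_ 0 0) := Dv (grad f) (ex_intro _ f (conj Vf erefl)).
  rewrite mxE [RHS]mxE => Dv0; rewrite -[RHS]Dv0; apply: eq_bigr => j _.
  rewrite mxE /v'.
  by case: ifP; rewrite ?mul0r ?mulr0.
apply/matrixP => a b; rewrite !ord1 !mxE (bigD1 i) //= !mxE !eqxx mul1r big1.
  by have := v'0 i; rewrite /v' fi addr0.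
by move=> j ji; rewrite !mxE eqxx (negbTE ji) mul0r.
Qed.

(** A bound on 1 / det in polynomial form: if the determinant tended to 0 along such points of V
    converging to z0, so would e, whose value at z0 is 1. *)
Lemma jacobian_divides_unit : exists b e : MP, e.@[z0] = 1 /\
  forall w, V w -> \det (jacobian w) != 0 -> \det (jacobian w) * b.@[w] = e.@[w].
Proof.
have /choice[f fP] i : exists f : MP, free i -> (forall w, V w -> f.@[w] = 0) /\
    forall j, free j -> (f^`M(j)).@[z0] = (i == j)%:R.
  case fi: (free i); last by exists 0.
  by have [f fP] := exists_coordinate fi; exists f.
pose F i w := if free i then translate free w (f i) else 'X_i.
have Frad i : in_radical (F i).
  case fi: (free i); last first.
    by rewrite (_ : F i = system i) ?/F ?/system; [exact: in_radical_sys|apply/funext => w; rewrite fi].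
  rewrite (_ : F i = fun w => translate free w (f i)).
    by apply: in_radical_translate; exact: (fP i fi).1.
  by apply/funext => w; rewrite /F fi.
have /choice[N NP] i := polyfam_split (Frad i).1.
(* The linear parts of the [F i] are the coordinates only at z0. Elsewhere Cramer's rule yields
   [E w * 'X_l], and the constant term of [E] is 1 at z0. *)
pose E w := \det (\matrix_(i, j) N i j w).
have FN w i : V w -> \sum_l (\matrix_(i, j) N i j w) i l * 'X_l = F i w.
  move=> Vw; have [_ -> _] := NP i; rewrite (_ : (F i w)@_0%MM = 0).
    by rewrite mpolyC0 add0r; apply: eq_bigr => l _; rewrite mxE.
  rewrite /F; case fi: (free i); last by rewrite mcoeffX mnm1_eq0.
  by rewrite translate_mcoeff0 (fP i fi).1.
have pN i j : polyfam (N i j) by have [] := NP i.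
have pE : polyfam E by exact: polyfam_det.
have EX l : in_radical (fun w => E w * 'X_l).
  split; first by apply: polyfamM => //; exact: polyfam_cst.
  have adjF i : in_radical (fun w => (\adj (\matrix_(i, j) N i j w)) l i * F i w).
    by apply: in_radicalM => //; exact: polyfam_adj.
  have [_ [k Jk]] := in_radical_sum adjF; exists k.
  apply: in_sys_ext Jk => w Vw; congr (_ ^+ _); apply/esym.
  exact: (det_mul_eq_adj_sum (FN w ^~ Vw)).
have /choice[kk kkP] l := (EX l).2.
(* One exponent for all coordinates; its successor is the power that [residue_transformation]
   expects. *)
pose k := (\max_l kk l)%N.
have /choice[a aP] l : in_sys (fun w => (E w * 'X_l) ^+ k.+1).
  apply: (in_sys_expW (EX l).1 _ (kkP l)); apply: leqW; exact: leq_bigmax.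
have [P [pP sysP jacP]] := system_split.
have [b bE] := polyfam_mcoeff (topmon k) (polyfam_det (fun i j => (aP i).1 j)).
have [e eE] := polyfam_mcoeff 0%MM (polyfamX (k.+1 * n)%N pE).
exists b, e; split.
  rewrite -eE (rmorphXn (mcoeff 0%MM)) /= /E -det_map_mx.
  rewrite (_ : map_mx _ _ = 1%:M) ?det1 ?expr1n //; apply/matrixP => i j; rewrite !mxE.
  have [_ _ NU] := NP i; rewrite -[LHS]/((N i j z0)@_0%MM) NU /F; case fi: (free i).
    rewrite translate_mcoeffU; case fj: (free j); first by rewrite (fP i fi).2.
    by case: eqP => // ij; rewrite -ij fi in fj.
  by rewrite mcoeffXU.
move=> w Vw jac0; rewrite -bE -eE exprM (rmorphXn (mcoeff 0%MM)) /= -jacP //.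
apply: residue_transformation; last by apply: mulfI; rewrite jacP.
move=> i; under eq_bigr do rewrite mxE mulr_suml.
rewrite exchange_big /= -exprMn (aP i).2 //; apply: eq_bigr => j _.
rewrite mxE -sysP // mulr_sumr.
by apply: eq_bigr => l _; rewrite mulrA.
Qed.
End ReducedComplete.

(** * Derivatives of the Lagrangian *)

Section LagrangianDerivatives.
Local Open Scope classical_set_scope.
Local Open Scope ring_scope.
Context (R : realType) (F : framework).
Local Notation C := R[i].
Local Notation MP := {mpoly C[(K F)]}.
Implicit Types (p q : MP) (a b : AVar F) (e : edge F) (w v : pt R (K F)).

Lemma dpolyD a p q : dpoly a (p + q) = dpoly a p + dpoly a q.
Proof. exact: mderivD. Qed.

Lemma dpolyB a p q : dpoly a (p - q) = dpoly a p - dpoly a q.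
Proof. exact: mderivB. Qed.

Lemma dpolyM a p q : dpoly a (p * q) = dpoly a p * q + p * dpoly a q.
Proof. exact: mderivM. Qed.

Lemma dpoly_sum (I : finType) a (f : I -> MP) :
  dpoly a (\sum_i f i) = \sum_i dpoly a (f i).
Proof. exact: raddf_sum. Qed.

Lemma dpoly_Xv a b : dpoly a (Xv R b) = (a == b)%:R.
Proof.
by rewrite /dpoly /Xv mderivXU (inj_eq enum_rank_inj).
Qed.

Lemma dpoly_comm a b p : dpoly a (dpoly b p) = dpoly b (dpoly a p).
Proof. exact: mderiv_comm. Qed.

Definition islam a : bool := isint a && ~~ isxd a.

Lemma islamP a : islam a -> exists e, a = aLam e.
Proof.
by case: a => [v|[c|[b|c]]]; rewrite /islam /= ?andbN // => _;
  [exists (inl b)|exists (inr c)].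
Qed.

Lemma islam_aLam e : islam (aLam e).
Proof. by case: e. Qed.

Lemma isxd_aLam e : isxd (aLam e) = false.
Proof. by case: e. Qed.

Lemma isint_aLam e : isint (aLam e).
Proof. by case: e. Qed.

Lemma isxd_isint a : isxd a -> isint a.
Proof. by case: a => [v|[c|e]]. Qed.

Lemma aLam_inj : injective (@aLam F).
Proof. by move=> [b|c] [b'|c'] //= []->. Qed.

Lemma sum_isint (V : nmodType) (f : AVar F -> V) :
  \sum_(a | isint a) f a = \sum_(a | isxd a) f a + \sum_e f (aLam e).
Proof.
rewrite !big_sumType /= -!addrA; congr (_ + _); congr (_ + _).
by rewrite !big_pred0_eq !add0r.
Qed.

(** Independence of the multipliers, stated as invariance under translation so that it passes
    through sums and products. *)
Definition lamfree p := forall v, (forall a, ~~ islam a -> acoord v a = 0) ->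
  translate predT v p = p.

Lemma lamfreeB p q : lamfree p -> lamfree q -> lamfree (p - q).
Proof. by move=> hp hq v v0; rewrite rmorphB /= hp ?hq. Qed.

Lemma lamfreeM p q : lamfree p -> lamfree q -> lamfree (p * q).
Proof. by move=> hp hq v v0; rewrite rmorphM /= hp ?hq. Qed.

Lemma lamfreeC c : lamfree c%:MP.
Proof. by move=> v v0; rewrite translateC. Qed.

Lemma lamfree_sum (I : finType) (f : I -> MP) :
  (forall i, lamfree (f i)) -> lamfree (\sum_i f i).
Proof.
move=> hf v v0; rewrite rmorph_sum; apply: eq_bigr => i _; exact: hf.
Qed.

Lemma lamfreeX a : ~~ islam a -> lamfree (Xv R a).
Proof. by move=> la v /(_ a la) va; rewrite translateXU [v _]va mpolyC0 addr0. Qed.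

Lemma lamfree_dist2 i j : lamfree (dist2 R (F := F) i j).
Proof.
by apply: lamfree_sum => k; rewrite expr2; apply: lamfreeM; apply: lamfreeB;
  apply: lamfreeX; rewrite /islam /= andbN.
Qed.

Lemma lamfree_gpoly e : lamfree (gpoly R e).
Proof.
case: e => [b|c]; apply: lamfreeB; rewrite ?expr2; try exact: lamfree_dist2.
  by apply: lamfreeM; apply: lamfreeX; rewrite /islam /= andbN.
by apply: lamfreeM; apply: lamfreeX.
Qed.

Lemma lamfree_Qpoly : lamfree (Qpoly R F).
Proof.
apply: lamfree_sum => c; rewrite expr2.
apply: lamfreeM; first apply: lamfreeM; first exact: lamfreeC.
  by apply: lamfreeX; rewrite /islam /= andbN.
by apply: lamfreeM; apply: lamfreeB; apply: lamfreeX; rewrite /islam //= andbN.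
Qed.

Lemma mderiv_translate v p i : (translate predT v p)^`M(i) = translate predT v p^`M(i).
Proof.
have := (translateD predT v, translateM predT v); have := translateXU predT v.
have : translate predT v 1 = 1 by exact: rmorph1.
have : translate predT v 0 = 0 by exact: rmorph0.
have := translateC predT v.
(* Generalising [translate] keeps unification from unfolding it. *)
move: (translate predT v) => T TC T0 T1 TX [TD TM].
elim/(@mpoly_rect_ring C (K F)): p => [c|j|p q hp hq|p q hp hq].
- by rewrite TC mderivC T0.
- by rewrite TX mderivD mderivC addr0 !mderivXU; case: eqP.
- by rewrite TD !mderivD hp hq TD.
- by rewrite TM !mderivM hp hq TD !TM.
Qed.
End LagrangianDerivatives.

Lemma poly_horner_eq0 (C : numDomainType) (p : {poly C}) :
  (forall s, p.[s] = 0) -> p = 0.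
Proof.
move=> p0; apply/eqP; apply: contraT => pn0.
have := @max_poly_roots C p [seq i%:R | i <- iota 0 (size p)] pn0.
rewrite size_map size_iota ltnn => -> //.
  by apply/allP => s _; apply/eqP/p0.
by rewrite map_inj_uniq ?iota_uniq // => i j /eqP; rewrite eqr_nat => /eqP.
Qed.

Lemma line_derivative (C : numDomainType) n (f : {mpoly C[n]}) (w v : 'I_n -> C) :
  (forall s, f.@[fun i => s * v i + w i] = 0) -> \sum_i (f^`M(i)).@[w] * v i = 0.
Proof.
move=> f0.
(* The restriction to the line as a univariate polynomial; for f it has every scalar as a root, and
   its derivative at 0 is the sum sought. *)
pose h (p : {mpoly C[n]}) : {poly C} := mmap polyC (fun i => v i *: 'X + (w i)%:P) p.
have hC c : h c%:MP = c%:P by rewrite /h mmapC.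
have hX i : h 'X_i = v i *: 'X + (w i)%:P by rewrite /h mmapX mmap1U.
have hD p q : h (p + q) = h p + h q by exact: mmapD.
have hM p q : h (p * q) = h p * h q by exact: rmorphM.
have hE s p : (h p).[s] = p.@[fun i => s * v i + w i].
  elim/(@mpoly_rect_ring C n): p => [c|i|p q hp hq|p q hp hq].
  - by rewrite hC hornerC mevalC.
  - by rewrite hX !hornerE mevalXU mulrC.
  - by rewrite hD hornerD mevalD hp hq.
  - by rewrite hM hornerM mevalM hp hq.
have h0 p : (h p).[0] = p.@[w].
  by rewrite hE; apply: meval_eq => i; rewrite mul0r add0r.
suff <- : ((h f)^`()).[0] = \sum_i (f^`M(i)).@[w] * v i.
  by rewrite (@poly_horner_eq0 _ (h f)) ?deriv0 ?horner0 // => s; rewrite hE.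
elim/(@mpoly_rect_ring C n): f {f0} => [c|i|p q hp hq|p q hp hq].
- by rewrite hC derivC horner0 big1 // => i _; rewrite mderivC meval0 mul0r.
- rewrite hX derivD derivZ derivX derivC addr0 hornerZ hornerC mulr1.
  rewrite (bigD1 i) //= mderivXU eqxx meval1 mul1r big1 ?addr0 // => j ji.
  by rewrite mderivXU (negbTE ji) meval0 mul0r.
- rewrite hD derivD hornerD hp hq -big_split /=.
  by apply: eq_bigr => i _; rewrite mderivD mevalD mulrDl.
- rewrite hM derivM hornerD !hornerM hp hq !h0 mulr_suml mulr_sumr -big_split /=.
  by apply: eq_bigr => i _; rewrite mderivM mevalD !mevalM; ring.
Qed.

(** * The Lagrange equations and noncritical points *)

Section CatastropheSet.
Local Open Scope classical_set_scope.
Local Open Scope ring_scope.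
Context (R : realType) (F : framework) (Om : set (pt R (m2 F))).
Local Notation C := R[i].
Local Notation MP := {mpoly C[(K F)]}.
Implicit Types (p q : MP) (a b : AVar F) (e : edge F) (w v : pt R (K F)).
Local Notation L := (Lpoly R F).
Local Notation free := (fun i : 'I_(K F) => isint (enum_val i)).

Lemma evD w p q : ev w (p + q) = ev w p + ev w q. Proof. exact: mevalD. Qed.
Lemma evM w p q : ev w (p * q) = ev w p * ev w q. Proof. exact: mevalM. Qed.
Lemma ev0 w : ev w 0 = 0. Proof. exact: meval0. Qed.
Lemma ev_Xv w a : ev w (Xv R a) = acoord w a. Proof. exact: mevalXU. Qed.
Lemma ev_sum w (I : finType) (f : I -> MP) : ev w (\sum_i f i) = \sum_i ev w (f i).
Proof. exact: raddf_sum. Qed.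

Lemma dpoly_aLam_dist2 e i j : dpoly (aLam e) (dist2 R (F := F) i j) = 0.
Proof.
rewrite dpoly_sum big1 // => k _; rewrite expr2 dpolyM dpolyB !dpoly_Xv.
by case: e => ?; rewrite subrr mul0r mulr0 addr0.
Qed.

Lemma dpoly_aLam_gpoly e e' : dpoly (aLam e) (gpoly R e') = 0.
Proof.
case: e' => c; rewrite dpolyB dpoly_aLam_dist2 expr2 dpolyM dpoly_Xv;
by case: e => ?; rewrite mul0r mulr0 addr0 subr0.
Qed.

Lemma dpoly_aLam_Qpoly e : dpoly (aLam e) (Qpoly R F) = 0.
Proof.
rewrite dpoly_sum big1 // => c _.
rewrite expr2 !dpolyM !dpolyB !dpoly_Xv /dpoly mderivC.
by case: e => ?; rewrite /= subrr !(mul0r, mulr0, addr0).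
Qed.

Lemma dpoly_aLam_L e : dpoly (aLam e) L = gpoly R e.
Proof.
rewrite dpolyD dpoly_aLam_Qpoly add0r dpoly_sum (bigD1 e) //= big1 => [|e' ne].
  by rewrite dpolyM dpoly_aLam_gpoly dpoly_Xv eqxx mul1r mulr0 !addr0.
rewrite dpolyM dpoly_aLam_gpoly dpoly_Xv (inj_eq (@aLam_inj F)) eq_sym (negbTE ne).
by rewrite mul0r mulr0 addr0.
Qed.

Lemma dpoly_xd_L a : isxd a ->
  dpoly a L = dpoly a (Qpoly R F) + \sum_e Xv R (aLam e) * dpoly a (gpoly R e).
Proof.
move=> xa; rewrite dpolyD [X in _ + X]dpoly_sum; congr (_ + _); apply: eq_bigr => e _.
rewrite dpolyM dpoly_Xv; case: eqP => [ae|_]; last by rewrite mul0r add0r.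
by rewrite ae isxd_aLam in xa.
Qed.

Lemma ev_hess w a b : isxd a -> isxd b -> ev w (dpoly a (dpoly b L)) = hess w a b.
Proof.
move=> xa xb; rewrite dpoly_xd_L // dpolyD evD [X in _ + ev _ X]dpoly_sum ev_sum; congr (_ + _).
apply: eq_bigr => e _; rewrite dpolyM dpoly_Xv evD !evM ev_Xv.
case: eqP => [ae|_]; last by rewrite ev0 mul0r add0r.
by rewrite ae isxd_aLam in xa.
Qed.

Lemma isint_cases a : isint a -> isxd a \/ exists e, a = aLam e.
Proof.
by case xa: (isxd a) => ia; [left|right; apply: islamP; rewrite /islam ia xa].
Qed.

Lemma piLC_coord w j : piLC w j = w (enum_rank (aF (val (enum_val j)))).
Proof. by []. Qed.

Lemma isint_ctrl (j : 'I_(m2 F)) : isint (aF (val (enum_val j))) = false.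
Proof. by rewrite /= (valP (enum_val j)). Qed.

Lemma translate_L v : (forall a, ~~ islam a -> acoord v a = 0) ->
  translate predT v L = L + \sum_e (acoord v (aLam e))%:MP * gpoly R e.
Proof.
move=> v0; rewrite rmorphD /= lamfree_Qpoly // rmorph_sum -addrA; congr (_ + _).
rewrite -big_split /=; apply: eq_bigr => e _.
by rewrite rmorphM /= lamfree_gpoly // translateXU mulrDl.
Qed.

(** [Lpoly] is affine in the multipliers, so moving them by a left null vector of dg changes none of
    the equations. *)
Lemma LC_line w v : LC Om w -> (forall a, ~~ islam a -> acoord v a = 0) ->
  (forall a, isxd a -> \sum_e acoord v (aLam e) * ev w (dpoly a (gpoly R e)) = 0) ->
  LC Om (fun i => v i + w i).
Proof.
move=> [Omw Lw] v0 vJ; split.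
  rewrite (_ : piLC _ = piLC w) //; apply/funext => j; rewrite !piLC_coord.
  have -> : v (enum_rank (aF (val (enum_val j)))) = 0.
    by apply: v0; rewrite /islam isint_ctrl.
  by rewrite add0r.
move=> a ia; rewrite (_ : (fun i => _) = fun i => w i + v i); last first.
  by apply/funext => i; rewrite addrC.
rewrite /ev -(@translate_meval _ _ predT v w) // -mderiv_translate translate_L //.
rewrite mderivD mevalD [X in X + _]Lw // add0r.
rewrite -[LHS]/(ev w (dpoly a _)) dpoly_sum ev_sum.
case: (isint_cases ia) => [xa|[e' ->]].
  rewrite -[RHS](vJ a xa); apply: eq_bigr => e _; rewrite /ev /dpoly mderiv_mulC mevalM mevalC.
  by [].
by rewrite big1 // => e _; rewrite dpolyM dpoly_aLam_gpoly mulr0 /dpoly mderivC mul0r addr0 ev0.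
Qed.

(** A nonzero left null vector of dg would give a whole line inside the fibre of LC, by [LC_line],
    and the direction of that line would be a tangent vector killed by the projection. *)
Lemma noncritical_full_rank w (mu : edge F -> C) : LC Om w -> ~ critical Om w ->
  (forall a, isxd a -> \sum_e mu e * ev w (dpoly a (gpoly R e)) = 0) ->
  forall e, mu e = 0.
Proof.
move=> LCw ncw muJ e0; apply: contrapT => /eqP mu0; apply: ncw; split=> //; right.
pose v : pt R (K F) := fun i => \sum_e (enum_val i == aLam e)%:R * mu e.
have vlam e : acoord v (aLam e) = mu e.
  rewrite /acoord /v enum_rankK (bigD1 e) //= eqxx mul1r big1 ?addr0 // => e' ne.
  by rewrite (inj_eq (@aLam_inj F)) eq_sym (negbTE ne) mul0r.
have v0 a : ~~ islam a -> acoord v a = 0.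
  move=> la; rewrite /acoord /v enum_rankK big1 // => e _.
  by case: eqP => [ae|]; [rewrite ae islam_aLam in la|rewrite mul0r].
exists v; split.
- move=> f Vf; apply: line_derivative => s; apply: Vf.
  apply: (@LC_line w (fun i => s * v i)) => // a la.
    by rewrite /acoord -/(acoord v a) v0 // mulr0.
  transitivity (s * \sum_e mu e * ev w (dpoly a (gpoly R e))).
    rewrite mulr_sumr; apply: eq_bigr => e _.
    by rewrite -(vlam e) mulrA.
  by rewrite muJ ?mulr0.
- by exists (enum_rank (aLam e0)); rewrite -/(acoord v _) vlam.
- move=> j; rewrite piLC_coord -/(acoord v _) v0 //.
  by rewrite /islam isint_ctrl.
Qed.

Definition pullback (q : {mpoly C[(m2 F)]}) : MP :=
  mmap (@mpolyC (K F) C) (fun j => Xv R (aF (val (enum_val j)))) q.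
HB.instance Definition _ := GRing.RMorphism.copy pullback
  (mmap (@mpolyC (K F) C) (fun j => Xv R (aF (val (enum_val j))))).

Lemma pullbackC c : pullback c%:MP = c%:MP. Proof. exact: mmapC. Qed.

Lemma pullbackX j : pullback 'X_j = Xv R (aF (val (enum_val j))).
Proof. by rewrite /pullback mmapX mmap1U. Qed.

Lemma pullbackD (p q : {mpoly C[(m2 F)]}) : pullback (p + q) = pullback p + pullback q.
Proof. exact: rmorphD. Qed.

Lemma pullbackM (p q : {mpoly C[(m2 F)]}) : pullback (p * q) = pullback p * pullback q.
Proof. exact: rmorphM. Qed.

Lemma ev_pullback w (q : {mpoly C[(m2 F)]}) : ev w (pullback q) = q.@[piLC w].
Proof.
have := (pullbackD, pullbackM); have := pullbackX; have := pullbackC.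
move: pullback => T TC TX [TD TM].
elim/(@mpoly_rect_ring C (m2 F)): q => [c|j|p q hp hq|p q hp hq].
- by rewrite TC mevalC [LHS]mevalC.
- by rewrite TX ev_Xv mevalXU.
- by rewrite TD evD hp hq -mevalD.
- by rewrite TM evM hp hq -mevalM.
Qed.

Lemma translate_pullback w (q : {mpoly C[(m2 F)]}) : translate free w (pullback q) = (ev w (pullback q))%:MP.
Proof.
have := (pullbackD, pullbackM); have := pullbackX; have := pullbackC.
move: pullback => T TC TX [TD TM].
elim/(@mpoly_rect_ring C (m2 F)): q => [c|j|p q hp hq|p q hp hq].
- by rewrite TC translateC [ev _ _]mevalC.
- by rewrite TX translateXU /= enum_rankK isint_ctrl add0r ev_Xv.
- by rewrite TD translateD hp hq evD mpolyCD.
- by rewrite TM translateM hp hq evM mpolyCM.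
Qed.

Let G (i : 'I_(K F)) : MP := dpoly (enum_val i) L.
Let S0 : set MP := [set p | exists2 q : {mpoly C[(m2 F)]}, vanish Om q & p = pullback q].

Lemma LC_equations : zclosed Om -> forall w, LC Om w <->
  (forall i, free i -> (G i).@[w] = 0) /\ (forall p, S0 p -> p.@[w] = 0).
Proof.
move=> clOm w; split=> [[Omw Lw]|[Gw Sw]]; split.
- by move=> i; exact: Lw.
- by move=> _ [q Omq ->]; rewrite -[LHS]/(ev w _) ev_pullback Omq.
- by apply: clOm => q Omq; rewrite -ev_pullback; apply: Sw; exists q.
- by move=> a ia; have := Gw (enum_rank a); rewrite /G /= enum_rankK; apply.
Qed.

(** The bordered Hessian W, padded with the identity on the control coordinates. *)
Definition hessL w : 'M[C]_(K F) := jacobian free G w.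

(** A vector supported on the internal coordinates is killed by the projection, so noncriticality is
    exactly what supplies the unramifiedness at w. *)
Lemma critical_jacobian w : zclosed Om -> LC Om w -> ~ critical Om w ->
  exists b e : MP, ev w e = 1 /\ forall w', LC Om w' -> \det (hessL w') != 0 ->
    \det (hessL w') * ev w' b = ev w' e.
Proof.
move=> clOm LCw ncw; have S0t p w' : S0 p -> translate free w' p = (p.@[w'])%:MP.
  by move=> [q _ ->]; exact: translate_pullback.
apply: (jacobian_divides_unit (@uncountable_complex R) (LC_equations clOm) S0t).
move=> v v0 vT i; apply: contrapT => /eqP vi; apply: ncw; split=> //; right.
exists v; split=> //; first by exists i.
by move=> j; rewrite piLC_coord v0 //= enum_rankK isint_ctrl.
Qed.

(** At u = 0 the polynomial Q is det W. Where this is nonzero, Q stays nonzero for nearby w and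
    small u, so close points of one fibre coincide; this replaces the inverse function theorem. *)
Lemma fiber_local_injectivity : zclosed Om -> exists Q : {mpoly MP[(K F)]},
  (forall w, meval (fun=> 0) (map_mpoly (meval w) Q) = \det (hessL w)) /\
  forall w u, LC Om w -> LC Om (fun i => u i + w i) ->
    (forall a, ~~ isint a -> acoord u a = 0) ->
    forall l, meval u (map_mpoly (meval w) Q) * u l = 0.
Proof.
move=> clOm; have [Q [Q0 QV]] := fiber_injectivity (LC_equations clOm).
exists Q; split=> // w u LCw LCwu u0; apply: QV => // i ni.
by have := u0 _ ni; rewrite /acoord enum_valK.
Qed.
End CatastropheSet.

(** * Real structure and constrained forms *)

Section RealStructure.
Local Open Scope classical_set_scope.
Local Open Scope ring_scope.
Context (R : realType) (F : framework) (Om : set (pt R (m2 F))).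
Local Notation C := R[i].
Local Notation MP := {mpoly C[(K F)]}.
Implicit Types (p q : MP) (a b : AVar F) (e : edge F) (w v : pt R (K F)).
Local Notation L := (Lpoly R F).
Local Notation Re := (@complex.Re R).

Definition realpoly p := forall m, p@_m \is Num.real.

Lemma realpolyD p q : realpoly p -> realpoly q -> realpoly (p + q).
Proof. by move=> rp rq m; rewrite mcoeffD rpredD. Qed.

Lemma realpolyB p q : realpoly p -> realpoly q -> realpoly (p - q).
Proof. by move=> rp rq m; rewrite mcoeffB rpredB. Qed.

Lemma realpolyM p q : realpoly p -> realpoly q -> realpoly (p * q).
Proof. by move=> rp rq m; rewrite mcoeffM rpred_sum // => i _; rewrite rpredM. Qed.

Lemma realpoly_sum (I : finType) (f : I -> MP) :
  (forall i, realpoly (f i)) -> realpoly (\sum_i f i).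
Proof. by move=> rf m; rewrite raddf_sum rpred_sum // => i _; exact: rf. Qed.

Lemma realpoly_dpoly a p : realpoly p -> realpoly (dpoly a p).
Proof. by move=> rp m; rewrite mcoeff_mderiv rpredMn. Qed.

Lemma realpoly_Xv a : realpoly (Xv R a).
Proof. by move=> m; rewrite mcoeffX realn. Qed.

Lemma realpoly_dist2 i j : realpoly (dist2 R (F := F) i j).
Proof.
apply: realpoly_sum => k; rewrite expr2.
by apply: realpolyM; apply: realpolyB; exact: realpoly_Xv.
Qed.

Lemma realpoly_gpoly e : realpoly (gpoly R e).
Proof.
case: e => c; (apply: realpolyB; last exact: realpoly_dist2);
  by rewrite expr2; apply: realpolyM; exact: realpoly_Xv.
Qed.

Lemma realpoly_L : realpoly L.
Proof.
apply: realpolyD; apply: realpoly_sum => c; last first.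
  by apply: realpolyM; [exact: realpoly_Xv|exact: realpoly_gpoly].
rewrite expr2; apply: realpolyM; last first.
  by apply: realpolyM; apply: realpolyB; exact: realpoly_Xv.
apply: realpolyM; last exact: realpoly_Xv.
by move=> m; rewrite mcoeffC rpredM ?realn // realV realn.
Qed.

Lemma ev_real w p : isreal w -> realpoly p -> ev w p \is Num.real.
Proof.
move=> rw rp; rewrite /ev mevalE; apply: rpred_sum => m _.
by rewrite rpredM // rpred_prod // => i _; rewrite rpredX.
Qed.

Definition conjpt w : pt R (K F) := fun i => ((w i)^*)%C.

Lemma conjc_real (x : C) : x \is Num.real -> (x^*)%C = x.
Proof. by move=> /CrealP. Qed.

Lemma ev_conj w p : realpoly p -> ev (conjpt w) p = ((ev w p)^*)%C.
Proof.
move=> rp; rewrite /ev !mevalE rmorph_sum; apply: eq_bigr => m _.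
rewrite rmorphM rmorph_prod /= [conjc p@_m]conjc_real //; congr (_ * _).
by apply: eq_bigr => i _; rewrite rmorphXn.
Qed.

Lemma Re_real (x : C) : x \is Num.real -> x = ((Re x)%:C)%C.
Proof. by move=> /complex_realP[k ->]. Qed.

Lemma LC_conj w : LC Om w -> isreal (piLC w) -> LC Om (conjpt w).
Proof.
move=> [Omw Lw] rw; split.
  rewrite (_ : piLC _ = piLC w) //; apply/funext => j.
  by rewrite !piLC_coord; apply: conjc_real; exact: (rw j).
move=> a ia; rewrite ev_conj; last exact/realpoly_dpoly/realpoly_L.
by rewrite Lw // rmorph0.
Qed.

Local Notation xd := (fun i : 'I_(K F) => isxd (enum_val i)).
Local Notation row := (edge F + 'I_(K F))%type.
Local Notation lam := (fun e => enum_rank (aLam e)).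

(** Real parts make this and the matrices below defined and continuous along the whole path, before
    the lift is known to be real; at real points nothing is lost. *)
Definition Amx w (i j : 'I_(K F)) : R :=
  if xd i && xd j then Re (hess w (enum_val i) (enum_val j)) else 0.

(* The rows [inr i] force the coordinates other than x and delta to vanish. *)
Definition Bmx w (r : row) (j : 'I_(K F)) : R :=
  match r with
  | inl e => if xd j then Re (ev w (dpoly (enum_val j) (gpoly R e))) else 0
  | inr i => if xd i then 0 else (i == j)%:R
  end.

Definition Wmx w : 'M[R]_(K F) := map_mx Re (hessL w).

Lemma Amx_sym w i j : Amx w i j = Amx w j i.
Proof.
rewrite /Amx andbC; case: ifP => [/andP[xj xi]|_]; last by [].
by rewrite -(ev_hess w xi xj) -(ev_hess w xj xi) dpoly_comm.
Qed.

Lemma sum_enum_val (V : nmodType) (f : AVar F -> V) (P : pred (AVar F)) :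
  \sum_(i < K F | P (enum_val i)) f (enum_val i) = \sum_(a | P a) f a.
Proof.
rewrite [RHS](reindex (@enum_val _ {: AVar F})) //.
exact/onW_bij/enum_val_bij.
Qed.

Lemma WmxE w i j : Wmx w i j =
  if isint (enum_val i) then (if isint (enum_val j) then
    Re (ev w (dpoly (enum_val j) (dpoly (enum_val i) L))) else 0) else (i == j)%:R.
Proof.
rewrite !mxE /= /ev {2}/dpoly enum_valK; case: ifP => _; first by case: ifP.
by case: eqP.
Qed.

Lemma isintNxd a : ~~ isint a -> isxd a = false.
Proof. by move=> ia; apply: contraNF ia; exact: isxd_isint. Qed.

(** The block form of the bordered Hessian by columns: identity on the controls, A and the transpose
    of B on x and delta, and B with a zero block on the multipliers, since g does not involve
    them. *)
Lemma mul_Wmx w (v : 'rV[R]_(K F)) j :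
  [/\ ~~ isint (enum_val j) -> (v *m Wmx w) 0 j = v 0 j,
      xd j -> (v *m Wmx w) 0 j = \sum_i v 0 i * Amx w i j +
                                 \sum_e v 0 (lam e) * Bmx w (inl e) j &
      forall e, j = lam e -> (v *m Wmx w) 0 j = \sum_i Bmx w (inl e) i * v 0 i].
Proof.
rewrite mxE; split=> [nj|xj|e je].
- rewrite (bigD1 j) //= WmxE (negbTE nj) eqxx mulr1 big1 ?addr0 // => i ij.
  by rewrite WmxE (negbTE nj) (negbTE ij) if_same mulr0.
- rewrite (bigID (fun i => isint (enum_val i))) /= [X in _ + X]big1 => [|i ni]; last first.
    rewrite WmxE (negbTE ni); case: eqP => [ij|]; last by rewrite mulr0.
    by move: ni; rewrite ij isxd_isint.
  rewrite addr0 (eq_bigr (fun i => v 0 (enum_rank (enum_val i)) *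
      Re (ev w (dpoly (enum_val j) (dpoly (enum_val i) L))))); last first.
    by move=> i ii; rewrite enum_valK WmxE ii isxd_isint.
  rewrite (sum_enum_val (fun a => v 0 (enum_rank a) *
      Re (ev w (dpoly (enum_val j) (dpoly a L)))) (@isint F)) sum_isint.
  congr (_ + _); last first.
    by apply: eq_bigr => e _; rewrite dpoly_aLam_L /= xj.
  rewrite -(sum_enum_val _ (@isxd F)) big_mkcond /=; apply: eq_bigr => i _.
  rewrite /Amx xj andbT; case: ifP => xi; rewrite ?mulr0 // enum_valK.
  by rewrite dpoly_comm (ev_hess w xi xj).
- rewrite (bigID (fun i => isint (enum_val i))) /= [X in _ + X]big1 => [|i ni]; last first.
    rewrite WmxE (negbTE ni); case: eqP => [ij|]; last by rewrite mulr0.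
    by move: ni; rewrite ij je enum_rankK isint_aLam.
  rewrite addr0 (eq_bigr (fun i => v 0 (enum_rank (enum_val i)) *
      Re (ev w (dpoly (enum_val i) (gpoly R e))))); last first.
    move=> i ii; rewrite enum_valK WmxE ii je enum_rankK isint_aLam.
    by rewrite dpoly_comm dpoly_aLam_L.
  rewrite (sum_enum_val (fun a => v 0 (enum_rank a) *
      Re (ev w (dpoly a (gpoly R e)))) (@isint F)) sum_isint.
  rewrite [X in _ + X]big1 ?addr0 => [|e' _]; last first.
    by rewrite dpoly_aLam_gpoly ev0 mulr0.
  rewrite -(sum_enum_val _ (@isxd F)) big_mkcond /=; apply: eq_bigr => i _.
  by case: ifP; rewrite ?mul0r // enum_valK mulrC.
Qed.
End RealStructure.

Section ConstrainedForms.
Local Open Scope ring_scope.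
Context {R : realFieldType} {n : nat} {I : finType}.
Implicit Types (A : 'I_n -> 'I_n -> R) (B : I -> 'I_n -> R) (u v : 'rV[R]_n).

Definition annihilated B u := forall r, \sum_j B r j * u 0 j = 0.

Definition bform A u v := \sum_i \sum_j u 0 i * A i j * v 0 j.

Definition posdef_on A B := forall u, annihilated B u -> u != 0 -> 0 < bform A u u.

Lemma bformDl A u1 u2 v : bform A (u1 + u2) v = bform A u1 v + bform A u2 v.
Proof.
rewrite -big_split; apply: eq_bigr => i _; rewrite -big_split; apply: eq_bigr => j _.
by rewrite mxE /=; ring.
Qed.

Lemma bformZl A a u v : bform A (a *: u) v = a * bform A u v.
Proof.
rewrite mulr_sumr; apply: eq_bigr => i _; rewrite mulr_sumr; apply: eq_bigr => j _.
by rewrite mxE; ring.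
Qed.

Lemma bformC A u v : (forall i j, A i j = A j i) -> bform A u v = bform A v u.
Proof.
move=> sA; rewrite /bform exchange_big; apply: eq_bigr => i _; apply: eq_bigr => j _.
by rewrite sA; ring.
Qed.

Lemma bformE A u v : bform A u v = \sum_j (\sum_i u 0 i * A i j) * v 0 j.
Proof. by rewrite /bform exchange_big; apply: eq_bigr => j _; rewrite mulr_suml. Qed.

Lemma annihilatedDZ B a u v : annihilated B u -> annihilated B v ->
  annihilated B (u + a *: v).
Proof.
move=> Bu Bv r; transitivity (\sum_j B r j * u 0 j + a * \sum_j B r j * v 0 j).
  rewrite mulr_sumr -big_split; apply: eq_bigr => j _; rewrite !mxE /=; ring.
by rewrite Bu Bv mulr0 addr0.
Qed.

(** The form at u + s v equals 2 s b + s^2 c with c its value at v; nonnegativity for every s forces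
    the linear coefficient b to vanish. *)
Lemma semidefinite_isotropic A B u v : (forall i j, A i j = A j i) ->
  (forall w, annihilated B w -> 0 <= bform A w w) ->
  annihilated B u -> annihilated B v -> bform A u u = 0 -> bform A u v = 0.
Proof.
move=> sA psd Bu Bv u0; set b := bform A u v.
have bformZr a x y : bform A x (a *: y) = a * bform A x y.
  by rewrite bformC // bformZl bformC.
have bformDr x y z : bform A x (y + z) = bform A x y + bform A x z.
  by rewrite bformC // bformDl !(bformC _ x).
have q s : 0 <= 2%:R * s * b + s ^+ 2 * bform A v v.
  have := psd _ (annihilatedDZ s Bu Bv).
  rewrite bformDl !bformDr !bformZl !bformZr u0 (bformC v u) // -/b.
  by congr (_ <= _); ring.
have qv : 0 <= bform A v v by exact: psd.
have qv1 : 0 < 1 + bform A v v by lra.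
apply/eqP; rewrite -sqrf_eq0 eq_le sqr_ge0 andbT.
(* The parabola is minimal at - b / c; adding 1 keeps the denominator positive when c = 0, and the
   value is still negative unless b = 0. *)
have := q (- b / (1 + bform A v v)).
set c := bform A v v in qv qv1 *.
have -> : 2%:R * (- b / (1 + c)) * b + (- b / (1 + c)) ^+ 2 * c =
    - (b ^+ 2 * ((2%:R + c) / (1 + c) ^+ 2)).
  by field; rewrite gt_eqF.
rewrite oppr_ge0 pmulr_lle0 // divr_gt0 ?exprn_gt0 //; lra.
Qed.

(** The row space is its own double annihilator. This produces the multipliers in
    [semidefinite_posdef]. *)
Lemma annihilator_combination B (e : 'rV[R]_n) :
  (forall v, annihilated B v -> \sum_j e 0 j * v 0 j = 0) ->
  exists c : I -> R, forall j, e 0 j = \sum_r c r * B r j.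
Proof.
move=> Be; pose D := [set d : 'rV[R]_n | exists c : I -> R, forall j, d 0 j = \sum_r c r * B r j]%classic.
suff : D e by [].
apply: span_of_annihilator => [|u v [c cE] [d dE]|a u [c cE]|v Dv].
- by exists (fun=> 0) => j; rewrite mxE big1 // => r _; rewrite mul0r.
- exists (fun r => c r + d r) => j; rewrite mxE cE dE -big_split.
  by apply: eq_bigr => r _; rewrite mulrDl.
- exists (fun r => a * c r) => j; rewrite mxE cE mulr_sumr.
  by apply: eq_bigr => r _; rewrite mulrA.
- apply/matrixP => i k; rewrite !ord1 !mxE.
  rewrite -[RHS](Be (v^T)) => [|r].
    by apply: eq_bigr => j _; rewrite mxE.
  have Dr : D (\row_j B r j).
    exists (fun r' => (r' == r)%:R) => j; rewrite mxE (bigD1 r) //= eqxx mul1r.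
    by rewrite big1 ?addr0 // => r' rr; rewrite (negbTE rr) mul0r.
  have /matrixP/(_ 0 0) := Dv _ Dr; rewrite !mxE => Dv0; rewrite -[RHS]Dv0.
  by apply: eq_bigr => j _; rewrite !mxE.
Qed.
End ConstrainedForms.

(** * Definiteness on ker dg and invertibility of the bordered Hessian *)

Section StrictLocalMinima.
Local Open Scope classical_set_scope.
Local Open Scope ring_scope.
Context (R : realType) (F : framework) (Om : set (pt R (m2 F))).
Local Notation C := R[i].
Implicit Types (a b : AVar F) (e : edge F) (w : pt R (K F)).
Local Notation Re := (@complex.Re R).
Local Notation xd := (fun i : 'I_(K F) => isxd (enum_val i)).
Local Notation lam := (fun e => enum_rank (aLam e)).

Lemma annihilated_xd w (u : 'rV[R]_(K F)) i :
  annihilated (Bmx w) u -> ~~ xd i -> u 0 i = 0.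
Proof.
move=> Bu xi; rewrite -[RHS](Bu (inr i)) (bigD1 i) //= big1 => [|j ji].
  by rewrite (negbTE xi) eqxx mul1r addr0.
by rewrite (negbTE xi) eq_sym (negbTE ji) mul0r.
Qed.

Lemma annihilatedP w (u : 'rV[R]_(K F)) :
  (forall i, ~~ xd i -> u 0 i = 0) ->
  (forall e, \sum_i Bmx w (inl e) i * u 0 i = 0) -> annihilated (Bmx w) u.
Proof.
move=> u0 ue [e|i]; first exact: ue.
rewrite big1 //= => j _; case: ifPn => xi; first by rewrite mul0r.
by case: (eqVneq i j) => [<-|_]; [rewrite u0 ?mulr0|rewrite mul0r].
Qed.

Lemma annihilated_sum w (u v : 'rV[R]_(K F)) (c : edge F -> R) :
  annihilated (Bmx w) u ->
  \sum_j (\sum_e c e * Bmx w (inl e) j) * u 0 j = 0.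
Proof.
move=> Bu; under eq_bigr do rewrite mulr_suml.
rewrite exchange_big big1 // => e _.
transitivity (c e * \sum_j Bmx w (inl e) j * u 0 j); last by rewrite Bu mulr0.
by rewrite mulr_sumr; apply: eq_bigr => j _; rewrite mulrA.
Qed.

Lemma coord_cases (i : 'I_(K F)) :
  [\/ ~~ isint (enum_val i), xd i | exists e, i = lam e].
Proof.
have [ii|ni] := boolP (isint (enum_val i)); last exact: Or31.
case: (isint_cases ii) => [xi|[e ae]]; [exact: Or32|apply: Or33; exists e].
by rewrite -ae enum_valK.
Qed.

(** For a left null vector of W, the (x, delta) part u lies in ker dg and A u is a combination of
    rows of dg, so the form vanishes at u and u = 0. The multiplier part is then a left null vector
    of dg, hence 0 by [noncritical_full_rank]. *)
Lemma posdef_det w : LC Om w -> isreal w -> ~ critical Om w ->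
  posdef_on (Amx w) (Bmx w) -> \det (Wmx w) != 0.
Proof.
move=> LCw rw ncw pd; apply/negP => /det0P[v v0 vW].
have vWj j : (v *m Wmx w) 0 j = 0 by rewrite vW mxE.
pose u : 'rV[R]_(K F) := \row_i (if xd i then v 0 i else 0).
have uA j : xd j -> \sum_i v 0 i * Amx w i j = \sum_i u 0 i * Amx w i j.
  move=> xj; apply: eq_bigr => i _; rewrite mxE; case: ifP => // xi.
  by rewrite /Amx xi /= mul0r mulr0.
have uB e : \sum_i Bmx w (inl e) i * u 0 i = 0.
  have [_ _ H] := mul_Wmx w v (lam e); rewrite -[RHS](vWj (lam e)) (H e erefl).
  by apply: eq_bigr => i _; rewrite mxE /=; case: ifP => // _; rewrite !mul0r.
have Bu : annihilated (Bmx w) u.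
  by apply: annihilatedP => // i /negbTE xi; rewrite mxE xi.
have uAe j : xd j -> \sum_i u 0 i * Amx w i j = - \sum_e v 0 (lam e) * Bmx w (inl e) j.
  move=> xj; have [_ H _] := mul_Wmx w v j.
  by apply/eqP; rewrite -uA // -addr_eq0 -H // vWj.
have u0 : u = 0.
  apply/eqP; apply: contraT => un0; have := pd u Bu un0.
  rewrite bformE (eq_bigr (fun j => - ((\sum_e v 0 (lam e) * Bmx w (inl e) j) * u 0 j))).
    by rewrite sumrN (annihilated_sum u _ Bu) oppr0 ltxx.
  move=> j _; case xj: (xd j); first by rewrite uAe // mulNr.
  by rewrite (annihilated_xd Bu) ?xj // !mulr0 oppr0.
have vxd i : xd i -> v 0 i = 0.
  by move=> xi; move/rowP/(_ i): u0; rewrite !mxE xi.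
have vlam e : v 0 (lam e) = 0.
  have := @noncritical_full_rank R F Om w (fun e => ((v 0 (lam e))%:C)%C) LCw ncw _ e.
  move=> H; suff /H[] : forall a, isxd a -> \sum_e ((v 0 (lam e))%:C)%C *
      ev w (dpoly a (gpoly R e)) = 0 by [].
  move=> a xa; have xj : xd (enum_rank a) by rewrite /= enum_rankK.
  have := uAe _ xj; rewrite u0 big1 => [|i _]; last by rewrite mxE mul0r.
  move=> /eqP; rewrite eq_sym oppr_eq0 => /eqP S0.
  transitivity ((\sum_e v 0 (lam e) * Bmx w (inl e) (enum_rank a))%:C)%C; last first.
    by rewrite S0.
  rewrite rmorph_sum; apply: eq_bigr => e' _; rewrite rmorphM /= enum_rankK xa.
  rewrite -Re_real //; apply: ev_real => //; apply: realpoly_dpoly.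
  exact: realpoly_gpoly.
case/negP: v0; apply/eqP/rowP => i; rewrite mxE.
case: (coord_cases i) => [ni|/vxd//|[e ->]]; last exact: vlam.
by have [H _ _] := mul_Wmx w v i; rewrite -(H ni).
Qed.

(** An isotropic vector u of a semidefinite form is orthogonal to ker dg, so A u is a combination of
    rows of dg; u together with the opposite coefficients is then a null vector of W. *)
Lemma semidefinite_posdef w : \det (Wmx w) != 0 ->
  (forall u, annihilated (Bmx w) u -> 0 <= bform (Amx w) u u) ->
  posdef_on (Amx w) (Bmx w).
Proof.
move=> detW psd u Bu u0; rewrite lt_neqAle psd // andbT eq_sym.
apply: contraNneq u0 => qu0.
have [|c cE] := @annihilator_combination _ _ _ (Bmx w) (\row_j \sum_i u 0 i * Amx w i j).
  move=> v Bv; have := semidefinite_isotropic (Amx_sym w) psd Bu Bv qu0.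
  rewrite bformE => q0; rewrite -[RHS]q0.
  by apply: eq_bigr => j _; rewrite mxE.
(* Only the coefficients of the rows [inl e] enter: the rows [inr i] vanish on the columns of x and
   delta. *)
pose v : 'rV[R]_(K F) := \row_i (u 0 i - \sum_e (i == lam e)%:R * c (inl e)).
have vxd i : ~~ islam (enum_val i) -> v 0 i = u 0 i.
  move=> li; rewrite mxE big1 ?subr0 // => e _.
  case: eqP => [ie|]; last by rewrite mul0r.
  by rewrite ie enum_rankK islam_aLam in li.
have xdNlam i : xd i -> ~~ islam (enum_val i) by rewrite /islam /= => ->; rewrite andbF.
have vlam e : v 0 (lam e) = - c (inl e).
  rewrite mxE (annihilated_xd Bu) ?enum_rankK ?isxd_aLam // add0r; congr (- _).
  rewrite (bigD1 e) //= eqxx mul1r big1 ?addr0 // => e' ne.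
  by rewrite (inj_eq enum_rank_inj) (inj_eq (@aLam_inj F)) eq_sym (negbTE ne) mul0r.
suff v0 : v = 0.
  apply/eqP/rowP => i; rewrite [RHS]mxE; case xi: (xd i).
    by rewrite -(vxd i (xdNlam i xi)) v0 mxE.
  by apply: (annihilated_xd Bu); rewrite xi.
apply/eqP; apply: contraT => vn0; case/negP: detW; apply/det0P; exists v => //.
apply/rowP => j; rewrite [RHS]mxE; have [H1 H2 H3] := mul_Wmx w v j.
case: (coord_cases j) => [nj|xj|[e je]].
- rewrite H1 // vxd; last by rewrite /islam (negbTE nj).
  by apply: (annihilated_xd Bu); rewrite (isintNxd nj).
- rewrite H2 //; have := cE j; rewrite mxE big_sumType /= [X in _ + X]big1 => [|i _].
    rewrite addr0 => uA.
    rewrite (eq_bigr (fun i => u 0 i * Amx w i j)); last first.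
      move=> i _; rewrite /Amx; case: ifP => [/andP[xi _]|]; last by rewrite !mulr0.
      by rewrite vxd // xdNlam.
    rewrite uA -big_split big1 //= => e _; rewrite vlam xj.
    by rewrite mulNr subrr.
  case: ifP => xi; first by rewrite mulr0.
  case: eqP => [ij|_]; last by rewrite mulr0.
  by rewrite -ij xi in xj.
- rewrite (H3 e) // -[RHS](Bu (inl e)); apply: eq_bigr => i _ /=.
  by case: ifP => [xi|]; rewrite ?mul0r // vxd // xdNlam.
Qed.
End StrictLocalMinima.

(** * Strict local minima as definiteness of a real form *)

Section StrictLocalMinimaPosdef.
Local Open Scope classical_set_scope.
Local Open Scope ring_scope.
Context (R : realType) (F : framework) (Om : set (pt R (m2 F))).
Local Notation C := R[i].
Implicit Types (a b : AVar F) (e : edge F) (w : pt R (K F)).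
Local Notation Re := (@complex.Re R).
Local Notation xd := (fun i : 'I_(K F) => isxd (enum_val i)).

Definition complexify n (u : 'rV[R]_n) : pt R n := fun i => ((u 0 i)%:C)%C.

Lemma isreal_complexify n (u : 'rV[R]_n) : isreal (complexify u).
Proof. by move=> i; apply/complex_realP; exists (u 0 i). Qed.

Lemma complexify_Re n (u : pt R n) : isreal u -> u = complexify (\row_i Re (u i)).
Proof. by move=> ru; apply/funext => i; rewrite /complexify mxE -Re_real. Qed.

Lemma real_complex_sum (I : finType) (f : I -> R) :
  ((\sum_i f i)%:C)%C = \sum_i ((f i)%:C)%C :> C.
Proof. exact: rmorph_sum. Qed.

Lemma real_complexM (x y : R) : ((x * y)%:C)%C = (x%:C)%C * (y%:C)%C :> C.
Proof. exact: rmorphM. Qed.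

Lemma hess_real w a b : isreal w -> isxd a -> isxd b ->
  hess w a b = ((Re (hess w a b))%:C)%C.
Proof.
move=> rw xa xb; apply: Re_real; rewrite -ev_hess //; apply: ev_real => //.
by do 2 apply: realpoly_dpoly; exact: realpoly_L.
Qed.

Lemma dg_real w a e : isreal w ->
  ev w (dpoly a (gpoly R e)) = ((Re (ev w (dpoly a (gpoly R e))))%:C)%C.
Proof.
move=> rw; apply: Re_real; apply: ev_real => //.
by apply: realpoly_dpoly; exact: realpoly_gpoly.
Qed.

Lemma annihilated_complexify w (u : 'rV[R]_(K F)) : isreal w ->
  annihilated (Bmx w) u <-> xdvec (complexify u) /\ null_dg w (complexify u).
Proof.
move=> rw.
have ue e : \sum_(a | isxd a) ev w (dpoly a (gpoly R e)) * acoord (complexify u) a =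
    ((\sum_i Bmx w (inl e) i * u 0 i)%:C)%C.
  rewrite -(sum_enum_val _ (@isxd F)) big_mkcond real_complex_sum.
  apply: eq_bigr => i _ /=; case: ifP => xi; last by rewrite mul0r.
  by rewrite real_complexM /acoord enum_valK -dg_real.
split=> [Bu|[xu nu]].
  split=> [a na|e]; last by rewrite ue (Bu (inl e)).
  by rewrite /acoord /complexify (annihilated_xd Bu) ?enum_rankK.
apply: annihilatedP => [i xi|e].
  by have := xu _ xi; rewrite /acoord enum_valK => /(congr1 Re).
by have := nu e; rewrite ue => /(congr1 Re).
Qed.

Lemma hess_form w (u : 'rV[R]_(K F)) : isreal w ->
  \sum_(a | isxd a) \sum_(b | isxd b)
    acoord (complexify u) a * hess w a b * acoord (complexify u) b =
  ((bform (Amx w) u u)%:C)%C.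
Proof.
move=> rw; rewrite -(sum_enum_val _ (@isxd F)) big_mkcond real_complex_sum.
apply: eq_bigr => i _; rewrite real_complex_sum; case: ifP => xi; last first.
  by rewrite big1 // => j _; rewrite /Amx xi mulr0 mul0r.
rewrite -(sum_enum_val _ (@isxd F)) big_mkcond; apply: eq_bigr => j _.
rewrite /Amx xi; case: ifP => xj /=; last by rewrite mulr0 mul0r.
by rewrite !real_complexM -hess_real // /acoord !enum_valK.
Qed.

Lemma bilinear_combination k (V : 'I_k -> pt R (K F)) (c : 'I_k -> C)
    (h : AVar F -> AVar F -> C) (U : pt R (K F)) :
  (forall i, U i = \sum_(j < k) c j * V j i) ->
  \sum_(j < k) \sum_(l < k) c j * (\sum_(a | isxd a) \sum_(b | isxd b)
     acoord (V j) a * h a b * acoord (V l) b) * c l =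
  \sum_(a | isxd a) \sum_(b | isxd b) acoord U a * h a b * acoord U b.
Proof.
move=> UE.
transitivity (\sum_(j < k) \sum_(l < k) \sum_(a | isxd a) \sum_(b | isxd b)
    (c j * acoord (V j) a) * h a b * (c l * acoord (V l) b)).
  apply: eq_bigr => j _; apply: eq_bigr => l _.
  rewrite mulr_sumr mulr_suml; apply: eq_bigr => a _.
  by rewrite mulr_sumr mulr_suml; apply: eq_bigr => b _; ring.
rewrite (eq_bigr (fun j => \sum_(a | isxd a) \sum_(l < k) \sum_(b | isxd b)
    (c j * acoord (V j) a) * h a b * (c l * acoord (V l) b))); last first.
  by move=> j _; rewrite exchange_big.
rewrite exchange_big; apply: eq_bigr => a _.
rewrite (eq_bigr (fun j => \sum_(b | isxd b) \sum_(l < k)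
    (c j * acoord (V j) a) * h a b * (c l * acoord (V l) b))); last first.
  by move=> j _; rewrite exchange_big.
rewrite exchange_big; apply: eq_bigr => b _.
rewrite /acoord !UE mulr_suml mulr_suml; apply: eq_bigr => j _.
by rewrite mulr_sumr.
Qed.

(** Eliminates the choice of the basis V, so that minima at different points can be compared; in the
    converse direction a row basis of the kernel of the constraints is supplied. *)
Lemma strict_local_min_posdef w :
  strict_local_min Om w <-> [/\ LC Om w, isreal w & posdef_on (Amx w) (Bmx w)].
Proof.
split=> [[LCw rw [k [V [Vr Vfree Vspan Vpos]]]]|[LCw rw pd]].
  split=> // u Bu u0; have [xu nu] := (annihilated_complexify u rw).1 Bu.
  have [c [rc uE]] := (Vspan _ (isreal_complexify u) xu).1 nu.
  have cn0 : exists j, c j != 0.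
    apply: contrapT => /forallNP c0; case/negP: u0; apply/eqP/rowP => i.
    have := uE i; rewrite big1 => [/(congr1 Re)|j _]; first by rewrite mxE.
    by have /negP := c0 j; rewrite negbK => /eqP->; rewrite mul0r.
  by have := Vpos c rc cn0; rewrite (bilinear_combination _ uE) hess_form // ltcR.
split=> //.
pose Bm := \matrix_(i < K F, r < #|{: edge F + 'I_(K F)}|) Bmx w (enum_val r) i.
have BmP (u : 'rV[R]_(K F)) : u *m Bm = 0 <-> annihilated (Bmx w) u.
  split=> [uB r|Bu].
    move/rowP/(_ (enum_rank r)): uB; rewrite !mxE => uB; rewrite -[RHS]uB.
    by apply: eq_bigr => j _; rewrite mxE enum_rankK mulrC.
  apply/rowP => r; rewrite !mxE -[RHS](Bu (enum_val r)).
  by apply: eq_bigr => j _; rewrite mxE mulrC.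
have [B BE] : exists B, B = row_base (kermx Bm) by exists (row_base (kermx Bm)).
pose V j := complexify (row j B).
have sumV (c : 'I__ -> R) i :
    \sum_j ((c j)%:C)%C * V j i = complexify ((\row_j c j) *m B) i.
  rewrite /complexify mxE real_complex_sum; apply: eq_bigr => j _.
  by rewrite real_complexM /V /complexify !mxE.
have realc k (c : 'I_k -> C) : realcoefs c -> c = fun j => ((Re (c j))%:C)%C.
  by move=> rc; apply/funext => j; rewrite -Re_real.
have Bann (c : 'rV_(\rank (kermx Bm))) : annihilated (Bmx w) (c *m B).
  apply/BmP/sub_kermxP; rewrite -(eq_row_base (kermx Bm)) -BE; exact: submxMl.
have Bfree c : c *m B = 0 -> c = 0.
  by move/eqP; rewrite mulmx_free_eq0 ?BE ?row_base_free // => /eqP.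
exists (\rank (kermx Bm)), V; split.
- move=> j; split; first exact: isreal_complexify.
  by have := Bann (delta_mx 0 j); rewrite -rowE => /(annihilated_complexify _ rw)[].
- move=> c /realc -> cV j; suff /rowP/(_ j) : \row_j Re (c j) = 0 by rewrite !mxE => ->.
  apply: Bfree; apply/rowP => i; rewrite [RHS]mxE.
  by have := cV i; rewrite sumV => /(congr1 Re).
- move=> u ru xu; rewrite (complexify_Re ru) in xu *; set ur := \row_i _ in xu *.
  split=> [nu|[c [/realc cE uE]]].
    have : (ur <= B)%MS.
      rewrite BE eq_row_base; apply/sub_kermxP/BmP.
      by apply/annihilated_complexify.
    move=> /submxP[c urE]; exists (fun j => ((c 0 j)%:C)%C); split=> [j|i].
      by apply/complex_realP; exists (c 0 j).
    rewrite sumV urE; congr (complexify (_ *m _) i).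
    by apply/rowP => j; rewrite mxE.
  have urE : ur = (\row_j Re (c j)) *m B.
    apply/rowP => i; have := uE i; rewrite cE sumV => /(congr1 Re) /= ->.
    by congr ((_ *m _) _ _); apply/rowP => j; rewrite !mxE.
  by have /(annihilated_complexify _ rw)[] := Bann (\row_j Re (c j)); rewrite -urE.
- move=> c /realc cE [j cj]; set cr := \row_j Re (c j).
  rewrite (@bilinear_combination _ V c _ (complexify (cr *m B))); last first.
    by move=> i; rewrite cE sumV; congr (complexify (_ *m _) i); apply/rowP => l; rewrite !mxE.
  rewrite hess_form // ltcR; apply: pd; first exact: Bann.
  apply: contra cj => /eqP/Bfree /rowP/(_ j); rewrite !mxE => cj0.
  by rewrite cE /= cj0.
Qed.
End StrictLocalMinimaPosdef.

(** * Continuity along the lift *)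

Section Continuity.
Import numFieldNormedType.Exports.
Local Open Scope classical_set_scope.
Local Open Scope ring_scope.
Context {R : realType}.
Local Notation C := R[i].
Local Notation Re := (@complex.Re R).
Local Notation Im := (@complex.Im R).
Implicit Types (f g : R -> R) (S : set R).

Lemma cvg_sumr {T : Type} {F : set_system T} {FF : Filter F} (I : Type)
    (r : seq I) (P : pred I) (f : I -> T -> R) (l : I -> R) :
  (forall i, f i @ F --> l i) ->
  (fun t => \sum_(i <- r | P i) f i t) @ F --> \sum_(i <- r | P i) l i.
Proof.
move=> cf; elim: r => [|i r IH].
  by rewrite big_nil; under eq_fun do rewrite big_nil; exact: cvg_cst.
rewrite big_cons; under eq_fun do rewrite big_cons.
by case: (P i) => //; apply: cvgD => //; exact: cf.
Qed.

Lemma continuous_sumr (I : Type) (r : seq I) (P : pred I) (f : I -> R -> R) :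
  (forall i, continuous (f i)) -> continuous (fun t => \sum_(i <- r | P i) f i t).
Proof. by move=> cf t; apply: cvg_sumr => i; exact: cf. Qed.

Lemma continuous_prodr (I : Type) (r : seq I) (P : pred I) (f : I -> R -> R) :
  (forall i, continuous (f i)) -> continuous (fun t => \prod_(i <- r | P i) f i t).
Proof.
move=> cf; elim: r => [|i r IH].
  by under eq_fun do rewrite big_nil; move=> t; exact: cvg_cst.
under eq_fun do rewrite big_cons.
case: (P i) => // t; apply: cvgM; [exact: cf|exact: IH].
Qed.

Lemma continuous_det n (M : R -> 'M[R]_n) :
  (forall i j, continuous (fun t => M t i j)) -> continuous (fun t => \det (M t)).
Proof.
move=> cM; apply: continuous_sumr => s t; apply: cvgM; first exact: cvg_cst.
by move: t; apply: continuous_prodr => i; exact: cM.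
Qed.

Lemma continuous_adj n (M : R -> 'M[R]_n) i j :
  (forall i j, continuous (fun t => M t i j)) -> continuous (fun t => (\adj (M t)) i j).
Proof.
move=> cM; under eq_fun do rewrite mxE; move=> t.
apply: cvgM; first exact: cvg_cst.
move: t; apply: continuous_det => a b; under eq_fun do rewrite !mxE; exact: cM.
Qed.

Lemma closure_eq0 S f t : continuous f -> (forall s, S s -> f s = 0) ->
  closure S t -> f t = 0.
Proof.
move=> cf Sf; have clf : closed (f @^-1` [set x | x = 0]).
  by have /continuous_closedP := cf; apply; exact: closed_eq.
move=> St; have := @closure_subset _ S (f @^-1` [set x | x = 0]) Sf t St.
by rewrite -(closure_id _).1.
Qed.

Lemma closure_ge0 S f t : continuous f -> (forall s, S s -> 0 <= f s) ->
  closure S t -> 0 <= f t.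
Proof.
move=> cf Sf; have clf : closed (f @^-1` [set x | 0 <= x]).
  by have /continuous_closedP := cf; apply; exact: closed_ge.
move=> St; have := @closure_subset _ S (f @^-1` [set x | 0 <= x]) Sf t St.
by rewrite -(closure_id _).1.
Qed.

Lemma smoothR_continuous f : smoothR f -> continuous f.
Proof.
move=> sf t; apply: differentiable_continuous; apply/derivable1_diffP; exact: (sf 0%N t).
Qed.

(** Continuity through real and imaginary parts, matching the form in which the lift is smooth. *)
Definition cpath (phi : R -> C) :=
  continuous (fun t => Re (phi t)) /\ continuous (fun t => Im (phi t)).

Lemma cpath_cst c : cpath (fun=> c).
Proof. by split => t; exact: cvg_cst. Qed.

Lemma cpathD p q : cpath p -> cpath q -> cpath (fun t => p t + q t).
Proof.
move=> [p1 p2] [q1 q2].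
have ReD (x y : C) : Re (x + y) = Re x + Re y by case: x; case: y.
have ImD (x y : C) : Im (x + y) = Im x + Im y by case: x; case: y.
split => t.
  by under eq_fun do rewrite ReD; rewrite ?ReD; apply: cvgD; [exact: p1|exact: q1].
by under eq_fun do rewrite ImD; rewrite ?ImD; apply: cvgD; [exact: p2|exact: q2].
Qed.

Lemma cpathM p q : cpath p -> cpath q -> cpath (fun t => p t * q t).
Proof.
move=> [p1 p2] [q1 q2].
have ReM (x y : C) : Re (x * y) = Re x * Re y - Im x * Im y by case: x; case: y.
have ImM (x y : C) : Im (x * y) = Re x * Im y + Im x * Re y by case: x; case: y.
split => t.
  under eq_fun do rewrite ReM; rewrite ?ReM; apply: cvgB; apply: cvgM.
  - exact: p1.
  - exact: q1.
  - exact: p2.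
  - exact: q2.
under eq_fun do rewrite ImM; rewrite ?ImM; apply: cvgD; apply: cvgM.
- exact: p1.
- exact: q2.
- exact: p2.
- exact: q1.
Qed.

Lemma cpath_meval n (z : R -> 'I_n -> C) (p : {mpoly C[n]}) :
  (forall i, cpath (z ^~ i)) -> cpath (fun t => p.@[z t]).
Proof.
move=> cz; elim/(@mpoly_rect_ring C n): p => [c|i|p q hp hq|p q hp hq].
- by under eq_fun do rewrite mevalC; exact: cpath_cst.
- by under eq_fun do rewrite mevalXU; exact: cz.
- by under eq_fun do rewrite mevalD; exact: cpathD.
- by under eq_fun do rewrite mevalM; exact: cpathM.
Qed.

Lemma cpath_meval2 n (z u : R -> 'I_n -> C) (Q : {mpoly {mpoly C[n]}[n]}) :
  (forall i, cpath (z ^~ i)) -> (forall i, cpath (u ^~ i)) ->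
  cpath (fun t => meval (u t) (map_mpoly (meval (z t)) Q)).
Proof.
move=> cz cu; elim/(@mpoly_rect_ring {mpoly C[n]} n): Q => [c|i|p q hp hq|p q hp hq].
- by under eq_fun do rewrite map_mpolyC mevalC; exact: cpath_meval.
- by under eq_fun do rewrite map_mpolyX mevalXU; exact: cu.
- rewrite (_ : (fun t => _) = fun t => meval (u t) (map_mpoly (meval (z t)) p) +
      meval (u t) (map_mpoly (meval (z t)) q)); first exact: cpathD.
  apply/funext => t; exact: (etrans (congr1 (meval (u t))
    (rmorphD (map_mpoly (meval (z t))) p q)) (mevalD _ _ _)).
- rewrite (_ : (fun t => _) = fun t => meval (u t) (map_mpoly (meval (z t)) p) *
      meval (u t) (map_mpoly (meval (z t)) q)); first exact: cpathM.
  apply/funext => t; exact: (etrans (congr1 (meval (u t))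
    (rmorphM (map_mpoly (meval (z t))) p q)) (mevalM _ _ _)).
Qed.

(* Compactness of the unit sphere makes definiteness on the kernel an open
   condition, with no assumption on the rank of B. *)
Lemma posdef_on_open n (I : finType) (A : R -> 'I_n -> 'I_n -> R) (B : R -> I -> 'I_n -> R) t0 :
  (forall i j, continuous (fun t => A t i j)) ->
  (forall r j, continuous (fun t => B t r j)) ->
  posdef_on (A t0) (B t0) -> \forall t \near t0, posdef_on (A t) (B t).
Proof.
move=> cA cB pd.
pose Sph := [set u : 'rV[R]_n | `|u| = 1].
have cSph : compact Sph.
  apply: bounded_closed_compact.
    exists 1; split; first exact: num_real.
    by move=> M M1 u /= ->; exact: ltW.
  have /continuous_closedP cn := @norm_continuous R 'rV[R]_n.
  exact: cn (@closed_eq R 1).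
(* Either a constraint fails at u or the form is positive there. Each alternative is open in (t, u),
   and at t0 every unit vector satisfies one of them. *)
pose P t (u : 'rV[R]_n) := (exists r, \sum_j B t r j * u 0 j != 0) \/ 0 < bform (A t) u u.
have nearP : forall u, Sph u -> \forall u' \near u & t \near t0, P t u'.
  move=> u Su; have FF : Filter (filter_prod (nbhs u) (nbhs t0)).
    exact: filter_prod_filter.
  change (filter_prod (nbhs u) (nbhs t0) [set p : 'rV[R]_n * R | P p.2 p.1]).
  have cu j : (fun p : 'rV[R]_n * R => p.1 0 j) @ filter_prod (nbhs u) (nbhs t0) --> u 0 j.
    apply: (@cvg_comp _ _ _ fst (fun v : 'rV[R]_n => v 0 j) _ (nbhs u)); first exact: cvg_fst.
    exact: coord_continuous.
  have cB' r j : (fun p : 'rV[R]_n * R => B p.2 r j) @ filter_prod (nbhs u) (nbhs t0) --> B t0 r j.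
    apply: (@cvg_comp _ _ _ snd (fun t => B t r j) _ (nbhs t0)); first exact: cvg_snd.
    exact: cB.
  have cA' i j : (fun p : 'rV[R]_n * R => A p.2 i j) @ filter_prod (nbhs u) (nbhs t0) --> A t0 i j.
    apply: (@cvg_comp _ _ _ snd (fun t => A t i j) _ (nbhs t0)); first exact: cvg_snd.
    exact: cA.
  have [Bu|] := pselect (annihilated (B t0) u).
    have u0 : u != 0.
      by apply: contra_eq_neq Su => ->; rewrite normr0 eq_sym oner_neq0.
    have cvgb : (fun p : 'rV[R]_n * R => bform (A p.2) p.1 p.1) @
        filter_prod (nbhs u) (nbhs t0) --> bform (A t0) u u.
      apply: (@cvg_sumr _ _ _ _ _ _
        (fun i (p : 'rV[R]_n * R) => \sum_j p.1 0 i * A p.2 i j * p.1 0 j)) => i.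
      apply: (@cvg_sumr _ _ _ _ _ _
        (fun j (p : 'rV[R]_n * R) => p.1 0 i * A p.2 i j * p.1 0 j)) => j.
      exact: (cvgM (cvgM (cu i) (cA' i j)) (cu j)).
    have h : filter_prod (nbhs u) (nbhs t0)
        [set p : 'rV[R]_n * R | 0 < bform (A p.2) p.1 p.1].
      exact: (cvgr_gt _ cvgb _ (pd u Bu u0)).
    by apply: (@filterS _ _ FF _ _ _ h) => -[u' t] /= ?; right.
  move=> /existsNP[r /eqP Br].
  have cvgb : (fun p : 'rV[R]_n * R => \sum_j B p.2 r j * p.1 0 j) @
      filter_prod (nbhs u) (nbhs t0) --> \sum_j B t0 r j * u 0 j.
    apply: (@cvg_sumr _ _ _ _ _ _
      (fun j (p : 'rV[R]_n * R) => B p.2 r j * p.1 0 j)) => j.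
    exact: (cvgM (cB' r j) (cu j)).
  have h : filter_prod (nbhs u) (nbhs t0)
      [set p : 'rV[R]_n * R | \sum_j B p.2 r j * p.1 0 j != 0].
    exact: (cvgr_neq0 _ cvgb Br).
  by apply: (@filterS _ _ FF _ _ _ h) => -[u' t] /= ?; left; exists r.
have /compact_near_coveringP ncov := cSph.
have h : nbhs t0 [set t | Sph `<=` P t].
  by apply: (ncov _ (nbhs t0) P _ nearP); exact: nbhs_filter.
apply: (@filterS _ _ (nbhs_filter t0) _ _ _ h) => t SP v Bv v0.
have nv : 0 < `|v| by rewrite normr_gt0.
have : Sph (`|v|^-1 *: v).
  by rewrite /Sph /= normrZ gtr0_norm ?invr_gt0 // mulVf ?gt_eqF.
move=> /SP[[r]|].
  move=> /eqP[]; transitivity (`|v|^-1 * \sum_j B t r j * v 0 j); last first.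
    by rewrite Bv mulr0.
  by rewrite mulr_sumr; apply: eq_bigr => j _; rewrite mxE; ring.
have -> : bform (A t) (`|v|^-1 *: v) (`|v|^-1 *: v) = `|v|^-1 ^+ 2 * bform (A t) v v.
  rewrite mulr_sumr; apply: eq_bigr => i _; rewrite mulr_sumr; apply: eq_bigr => j _.
  by rewrite !mxE; ring.
by rewrite pmulr_rgt0 // exprn_gt0 // invr_gt0.
Qed.
End Continuity.

(** * The set of times at which the lift is a minimum *)

Section LiftedPath.
Import numFieldNormedType.Exports.
Local Open Scope classical_set_scope.
Local Open Scope ring_scope.
Context (R : realType) (F : framework) (Om : set (pt R (m2 F))).
Local Notation C := R[i].
Implicit Types (w : pt R (K F)).
Local Notation Re := (@complex.Re R).
Local Notation Im := (@complex.Im R).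
Local Notation xd := (fun i : 'I_(K F) => isxd (enum_val i)).
Local Notation lam := (fun e => enum_rank (aLam e)).

Lemma det_hessL_real w : isreal w -> \det (hessL w) = ((\det (Wmx w))%:C)%C.
Proof.
move=> rw; rewrite -(det_map_mx (real_complex R)); congr (\det _).
apply/matrixP => i j; rewrite !mxE /=; apply: Re_real.
case: ifP => fi; last by exact: realn.
case: ifP => fj; last exact: real0.
apply: (ev_real rw) => m; rewrite mcoeff_mderiv rpredMn //.
by apply: realpoly_dpoly; exact: realpoly_L.
Qed.

Lemma isreal_of_conj w : (forall i, ((w i)^*)%C = w i) -> isreal w.
Proof. by move=> cw i; apply/CrealP; exact: cw. Qed.

Lemma real_ctrl w (a : AVar F) : isreal (piLC w) -> ~~ isint a ->
  acoord w a \is Num.real.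
Proof.
case: a => [v|a] //=; rewrite negbK => rw cv.
pose s : CVar F := Sub v cv.
have := rw (enum_rank s); rewrite piLC_coord enum_rankK; exact.
Qed.

Definition xdpart (v : 'rV[R]_(K F)) : 'rV[R]_(K F) := \row_i (if xd i then v 0 i else 0).

(* Transports a vector of the null space at one point to the null space at w;
   as w returns to that point it tends to a multiple of the given vector. *)
Lemma annihilated_transport w (x : 'rV[R]_(K F)) :
  (forall i, ~~ xd i -> x 0 i = 0) ->
  annihilated (Bmx w) (xdpart (x *m \adj (Wmx w))).
Proof.
move=> x0; apply: annihilatedP => [i /negbTE xi|e]; first by rewrite mxE xi.
set v := x *m _; have [_ _ H] := mul_Wmx w v (lam e).
transitivity ((v *m Wmx w) 0 (lam e)).
  rewrite (H e erefl); apply: eq_bigr => i _ /=; rewrite mxE.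
  by case: ifP => _; rewrite ?mul0r.
rewrite /v -mulmxA mul_adj_mx mul_mx_scalar mxE x0 ?mulr0 //.
by rewrite /= enum_rankK isxd_aLam.
Qed.

Lemma annihilated_mul_Wmx w u i : annihilated (Bmx w) u -> ~~ xd i ->
  (u *m Wmx w) 0 i = 0.
Proof.
move=> Bu xi; have [H1 _ H3] := mul_Wmx w u i.
case: (coord_cases i) => [ni|xi'|[e ie]].
- by rewrite H1 // (annihilated_xd Bu).
- by rewrite xi' in xi.
- by rewrite (H3 e ie) (Bu (inl e)).
Qed.

Context (z : R -> pt R (K F)).
Context (cz : forall i, cpath (z ^~ i)).

Lemma cpath_ev p : cpath (fun t => ev (z t) p).
Proof. exact: cpath_meval. Qed.

Lemma continuous_Amx i j : continuous (fun t => Amx (z t) i j).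
Proof.
have [/andP[xi xj]|/negbTE nx] := boolP (xd i && xd j); last first.
  rewrite (_ : (fun t => _) = fun=> 0); first by move=> t; exact: cvg_cst.
  by apply/funext => t; rewrite /Amx nx.
rewrite (_ : (fun t => _) = fun t =>
    Re (ev (z t) (dpoly (enum_val i) (dpoly (enum_val j) (Lpoly R F))))).
  exact: (cpath_ev _).1.
apply/funext => t; rewrite /Amx xi xj.
by congr Re; apply/esym; exact: ev_hess.
Qed.

Lemma continuous_Bmx r j : continuous (fun t => Bmx (z t) r j).
Proof.
case: r => [e|i] /=; last by move=> t; exact: cvg_cst.
by case: (isxd (enum_val j)); [exact: (cpath_ev _).1|move=> t; exact: cvg_cst].
Qed.

Lemma continuous_Wmx i j : continuous (fun t => Wmx (z t) i j).
Proof.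
have -> : (fun t => Wmx (z t) i j) = fun t => if isint (enum_val i) then
    (if isint (enum_val j) then
      Re (ev (z t) (dpoly (enum_val j) (dpoly (enum_val i) (Lpoly R F)))) else 0)
    else (i == j)%:R.
  by apply/funext => t; exact: WmxE.
case: (isint (enum_val i)); last by move=> t; exact: cvg_cst.
case: (isint (enum_val j)); last by move=> t; exact: cvg_cst.
exact: (cpath_ev _).1.
Qed.

Definition minimum_at t := isreal (z t) /\ posdef_on (Amx (z t)) (Bmx (z t)).

Context (clOm : zclosed Om).

(** Reality is a closed condition, but positivity survives the limit only as semidefiniteness.
    Invertibility of W at the limit, obtained from [critical_jacobian], makes it strict again
    through [semidefinite_posdef]. *)
Lemma closure_minimum (S : set R) t :
  (forall s, S s -> [/\ LC Om (z s), ~ critical Om (z s) & minimum_at s]) ->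
  LC Om (z t) -> ~ critical Om (z t) -> closure S t -> minimum_at t.
Proof.
move=> Sgood LCt nct St.
have rt : isreal (z t).
  move=> i; apply/complex_realP; exists (Re (z t i)).
  have Im0 : Im (z t i) = 0.
    apply: (closure_eq0 (S := S) (cz i).2) => // s /Sgood[_ _ [rs _]].
    by rewrite (Re_real (rs i)).
  by case: (z t i) Im0 => x y /= ->.
split=> //.
have detW : \det (Wmx (z t)) != 0.
  have [b [e [e1 be]]] := critical_jacobian clOm LCt nct.
  have cdet : continuous (fun s => \det (Wmx (z s))).
    by apply: continuous_det; exact: continuous_Wmx.
  (* This function vanishes on S, where det W is real and nonzero, hence also at t; there it would
     be -1 if det W were 0. *)
  have cphi : continuous (fun s => \det (Wmx (z s)) * Re (ev (z s) b) - Re (ev (z s) e)).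
    move=> s; apply: cvgB; last exact: (cpath_ev e).1.
    by apply: cvgM; [exact: cdet|exact: (cpath_ev b).1].
  have phi0 := closure_eq0 (S := S) cphi _ St.
  apply: contra_eqN (phi0 _) => [/eqP->|s Ss].
    by rewrite mul0r sub0r e1 /= oppr_eq0 oner_neq0.
  have [LCs ncs [rs pds]] := Sgood s Ss.
  have dW := posdef_det LCs rs ncs pds.
  have := be _ LCs; rewrite det_hessL_real // => /(_ _)/(congr1 Re).
  case: (ev (z s) b) => x y /= <-; first by rewrite mul0r subr0 subrr.
  by apply: contra_neq dW => /(congr1 Re).
apply: semidefinite_posdef => // u Bu.
pose x := u *m Wmx (z t); pose us s := xdpart (x *m \adj (Wmx (z s))).
have x0 i : ~~ xd i -> x 0 i = 0 by exact: annihilated_mul_Wmx.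
have cus i : continuous (fun s => us s 0 i).
  under eq_fun do rewrite !mxE.
  case: (isxd (enum_val i)); last by move=> s; exact: cvg_cst.
  apply: continuous_sumr => j s; apply: cvgM; first exact: cvg_cst.
  by move: s; apply: continuous_adj; exact: continuous_Wmx.
have cq : continuous (fun s => bform (Amx (z s)) (us s) (us s)).
  apply: continuous_sumr => i; apply: continuous_sumr => j s.
  by apply: cvgM; [apply: cvgM; [exact: cus|exact: continuous_Amx]|exact: cus].
have := closure_ge0 (S := S) cq _ St.
have -> : us t = \det (Wmx (z t)) *: u.
  rewrite /us /x -mulmxA mul_mx_adj mul_mx_scalar; apply/rowP => i; rewrite !mxE.
  by case: ifP => // xi; rewrite (annihilated_xd Bu) ?xi ?mulr0.
(* The factor det W enters squared, so its sign does not matter. *)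
rewrite bformZl bformC; last exact: Amx_sym.
rewrite bformZl mulrA -expr2 pmulr_rge0 ?exprn_even_gt0 //; apply=> s /Sgood[_ _ [rs pds]].
have Bus : annihilated (Bmx (z s)) (us s) by exact: annihilated_transport.
have [->|us0] := eqVneq (us s) 0; last exact: ltW (pds _ Bus us0).
by rewrite /bform big1 // => i _; rewrite big1 // => j _; rewrite !mxE mulr0.
Qed.

(** Near t, [z s] and its conjugate are close points of one fibre, so they coincide and [z s] is
    real. Definiteness persists by [posdef_on_open], which applies to the real-part matrices
    directly. *)
Lemma minimum_open t : LC Om (z t) -> ~ critical Om (z t) -> minimum_at t ->
  \forall s \near t, LC Om (z s) -> isreal (piLC (z s)) -> minimum_at s.
Proof.
move=> LCt nct [rt pdt].
have [Q [Q0 QV]] := fiber_local_injectivity clOm.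
pose u s : pt R (K F) := fun i => ((z s i)^*)%C - z s i.
have cu i : cpath (u ^~ i).
  have [c1 c2] := cz i; split.
    have -> : (fun s => Re (u s i)) = fun=> 0.
      by apply/funext => s; rewrite /u; case: (z s i) => x y /=; rewrite subrr.
    by move=> s; exact: cvg_cst.
  have -> : (fun s => Im (u s i)) = fun s => - Im (z s i) - Im (z s i).
    by apply/funext => s; rewrite /u; case: (z s i) => x y.
  by move=> s; apply: cvgB; [apply: cvgN|]; exact: c2.
pose D s := meval (u s) (map_mpoly (meval (z s)) Q).
have [cD1 cD2] : cpath D by exact: cpath_meval2.
(* The squared modulus turns nonvanishing of [D] into a statement about a continuous real
   function. *)
pose D2 s := Re (D s) * Re (D s) + Im (D s) * Im (D s).
have cD : continuous D2.
  move=> s; apply: cvgD; apply: cvgM; by [exact: cD1|exact: cD2].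
have D2t : D2 t != 0.
  have Dt : D t = ((\det (Wmx (z t)))%:C)%C.
    rewrite -det_hessL_real // -Q0 /D; apply: meval_eq => i.
    by rewrite /u conjc_real ?subrr //; exact: rt.
  rewrite /D2 Dt /= mulr0 addr0 mulf_neq0 //; exact: posdef_det LCt rt nct pdt.
have nearD : \forall s \near t, D2 s != 0 by exact: cvgr_neq0 (cD t) D2t.
have nearpd := posdef_on_open continuous_Amx continuous_Bmx pdt.
near=> s => LCs rs; split; last by near: s.
apply: isreal_of_conj => i.
have LCcs : LC Om (fun i => u s i + z s i).
  rewrite (_ : (fun _ => _) = conjpt (z s)); first exact: LC_conj.
  by apply/funext => j; rewrite /u subrK.
have u0 a : ~~ isint a -> acoord (u s) a = 0.
  move=> na; rewrite /acoord /u conjc_real ?subrr //.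
  exact: (real_ctrl rs na).
have /eqP := QV _ _ LCs LCcs u0 i; rewrite mulf_eq0 => /orP[/eqP Ds0|].
  have : D2 s != 0 by near: s; exact: nearD.
  by rewrite /D2 /D Ds0 /= !mul0r addr0 eqxx.
by rewrite /u subr_eq0 => /eqP.
Unshelve. all: by end_near.
Qed.
(** Connectedness of [0, 1]: the set of good times contains 0, is relatively open by [minimum_open]
    and relatively closed by [closure_minimum]. *)
Lemma minimum_along_path :
  (forall t, 0 <= t <= 1 ->
    [/\ LC Om (z t), ~ critical Om (z t) & isreal (piLC (z t))]) ->
  minimum_at 0 -> forall t, 0 <= t <= 1 -> minimum_at t.
Proof.
move=> zP min0; pose S := [set t : R | 0 <= t <= 1 /\ minimum_at t].
suff SE : S = `[0, 1]%classic.
  by move=> t t01; have [] : S t by rewrite SE /= in_itv.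
apply: (@segment_connected R 0 1).
- by exists 0; split; [rewrite lexx ler01|].
(* The implication makes all times outside [0, 1] members, so the interior also contains the good
   endpoints although the hypotheses on z hold only on the interval. *)
- exists (interior [set t : R | 0 <= t <= 1 -> minimum_at t]); first exact: open_interior.
  apply/seteqP; split=> t; last first.
    by rewrite /= in_itv /= => -[t01 /interior_subset /(_ t01)].
  move=> [t01 mt]; split; first by rewrite /= in_itv.
  have [LCt nct _] := zP t t01; have h := minimum_open LCt nct mt.
  by apply: (@filterS _ _ (nbhs_filter t) _ _ _ h) => s hs /zP[LCs _ rs]; exact: hs.
- exists (closure S); first exact: closed_closure.
  apply/seteqP; split=> t; last first.
    rewrite /= in_itv /= => -[t01 St]; split=> //; have [LCt nct _] := zP t t01.
    by apply: (closure_minimum _ LCt nct St) => s [/zP[LCs ncs _] ms].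
  move=> St; split; last exact: subset_closure.
  by have [t01 _] := St; rewrite /= in_itv.
Qed.
End LiftedPath.

Unset Implicit Arguments.
Set Strict Implicit.
Set Printing Implicit Defensive.

Theorem mainTheorem3 (R : realType) (F : framework)
    (Om : set (pt R (m2 F)))
    (y : R -> 'I_(m2 F) -> R) (z : R -> pt R (K F)) :
  (* standing assumptions on the framework and on Omega *)
  wf_graph F ->
  zclosed Om ->
  (forall k, dim_ge (zcl (OmR Om)) k <-> dim_ge Om k) ->
  complete_intersections R F ->
  (* y : [0,1] -> Omega_R smooth *)
  (forall j, smoothR (fun t => y t j)) ->
  (forall t, 0 <= t <= 1 -> OmR Om (realpt (y t))) ->
  (* z(0) in LC_reg, pi(z(0)) = y(0), dim T_{z(0)} LC = dim T_{y(0)} Omega *)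
  reg_point (LC Om) (z 0) ->
  piLC (z 0) = realpt (y 0) ->
  same_tdim (LC Om) (z 0) Om (realpt (y 0)) ->
  (* the path avoids the catastrophe discriminant *)
  (forall t, 0 <= t <= 1 -> ~ discriminant Om (realpt (y t))) ->
  (* z is a smooth lifting of y in LC starting at z(0) *)
  smooth_cpath z ->
  (forall t, 0 <= t <= 1 -> LC Om (z t) /\ piLC (z t) = realpt (y t)) ->
  strict_local_min Om (z 0) ->
  forall t, 0 <= t <= 1 -> strict_local_min Om (z t).
Proof.
move=> _ clOm _ _ _ _ _ _ _ avoid sz lift min0 t t01.
have cz i : cpath (z ^~ i).
  by have [s1 s2] := sz i; split; exact: smoothR_continuous.
apply/strict_local_min_posdef.
have zP s : 0 <= s <= 1 ->
    [/\ LC Om (z s), ~ critical Om (z s) & isreal (piLC (z s))].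
  move=> s01; have [LCs piE] := lift s s01; split=> //; last first.
    by rewrite piE => j; apply/complex_realP; exists (y s j).
  move=> cs; apply: (avoid s s01) => f Vf; apply: Vf.
  by exists (z s); split.
have [_ r0 p0] := (strict_local_min_posdef Om (z 0)).1 min0.
have [rt pdt] := minimum_along_path cz clOm zP (conj r0 p0) t01.
by split=> //; have [] := zP t t01.
Qed.
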